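(* Let $\nu$ be a real number and let $\phi$ be a parabolic or a hyperbolic automorphism of the open unit disk $\mathbb{D}$. Then the composition operator $C_\phi$, $C_\phi f=f\circ\phi$, is recurrent on $S_\nu$ if and only if $\nu<\frac12$.
   Context: For $\nu\in\mathbb{R}$, the weighted Dirichlet space $S_\nu$ is the Hilbert space of functions $f(z)=\sum_{n=0}^\infty a_nz^n$ analytic on $\mathbb{D}$ with $\|f\|_\nu^2=\sum_{n=0}^\infty |a_n|^2(n+1)^{2\nu}<\infty$. If $\phi$ is a linear fractional map taking $\mathbb{D}$ into itself, then $C_\phi$ is a bounded operator on every $S_\nu$. An automorphism of $\mathbb{D}$ (a linear fractional map of $\mathbb{D}$ onto itself), not the identity, is parabolic if it has exactly one fixed point in the Riemann sphere (which lies on the unit circle), and hyperbolic if it has two distinct fixed points on the unit circle. A bounded operator $T$ on a Banach space $X$ is recurrent if for every nonempty open set $U\subset X$ there is a positive integer $k$ with $U\cap T^{-k}(U)\neq\emptyset$ (equivalently, the set of vectors $x$ for which there is a strictly increasing sequence of positive integers $(k_n)$ with $T^{k_n}x\to x$ is dense in $X$). *)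

(* Defs.v *)
From Stdlib Require Import Reals ClassicalEpsilon.
From Coquelicot Require Import Coquelicot.
Open Scope R_scope.

(** * Linear fractional maps of the Riemann sphere *)

(* [None] is the point at infinity. *)
Definition sphere : Type := option C.

Record lft : Type := Lft {
  lft_a : C; lft_b : C; lft_c : C; lft_d : C;
  lft_det : (lft_a * lft_d - lft_b * lft_c)%C <> 0%C
}.

Definition lft_map (phi : lft) (p : sphere) : sphere :=
  match p with
  | Some z =>
      if Ceq_dec (lft_c phi * z + lft_d phi)%C 0%C then None
      else Some ((lft_a phi * z + lft_b phi) / (lft_c phi * z + lft_d phi))%C
  | None =>
      if Ceq_dec (lft_c phi) 0%C then None
      else Some (lft_a phi / lft_c phi)%C
  end.

Coercion lft_map : lft >-> Funclass.

(** * Automorphisms of the unit disk *)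

Definition in_disk (p : sphere) : Prop :=
  match p with Some z => Cmod z < 1 | None => False end.

Definition on_circle (p : sphere) : Prop :=
  match p with Some z => Cmod z = 1 | None => False end.

Definition disk_automorphism (phi : lft) : Prop :=
  (forall p : sphere, in_disk p -> in_disk (phi p)) /\
  (forall q : sphere, in_disk q -> exists p : sphere, in_disk p /\ phi p = q).

Definition not_identity (phi : lft) : Prop :=
  ~ (forall p : sphere, phi p = p).

Definition parabolic (phi : lft) : Prop :=
  disk_automorphism phi /\ not_identity phi /\
  exists! p : sphere, phi p = p.

Definition hyperbolic (phi : lft) : Prop :=
  disk_automorphism phi /\ not_identity phi /\
  exists p q : sphere,
    p <> q /\ on_circle p /\ on_circle q /\ phi p = p /\ phi q = q.

Definition disk : Type := {z : C | Cmod z < 1}.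

Definition to_sphere (z : disk) : sphere := Some (proj1_sig z).

Definition of_sphere (p : sphere) : in_disk p -> disk :=
  match p with
  | Some z => fun h => exist _ z h
  | None => fun h => False_rect disk h
  end.

Definition disk_map (phi : lft) (h : disk_automorphism phi) (z : disk) : disk :=
  of_sphere (phi (to_sphere z)) (proj1 h (to_sphere z) (proj2_sig z)).

Lemma to_sphere_disk_map (phi : lft) (h : disk_automorphism phi) (z : disk) :
  to_sphere (disk_map phi h z) = phi (to_sphere z).
Proof.
  unfold disk_map.
  generalize (proj1 h (to_sphere z) (proj2_sig z)).
  destruct (phi (to_sphere z)) as [w|]; intro H; [reflexivity | destruct H].
Qed.

(** * The weighted Dirichlet spaces *)

Definition power_series_on_disk (a : nat -> C) (f : disk -> C) : Prop :=
  forall z : disk,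
    @is_pseries C_AbsRing C_NormedModule a (proj1_sig z) (f z).

(* The Taylor coefficients of [f] at 0; unspecified when [f] is not analytic. *)
Definition taylor (f : disk -> C) : nat -> C :=
  epsilon (inhabits (fun _ : nat => RtoC 0))
    (fun a => power_series_on_disk a f).

Definition dirichlet_term (nu : R) (f : disk -> C) (n : nat) : R :=
  (Cmod (taylor f n)) ^ 2 * Rpower (INR n + 1) (2 * nu).

Definition dirichlet_space (nu : R) (f : disk -> C) : Prop :=
  power_series_on_disk (taylor f) f /\ ex_series (dirichlet_term nu f).

Definition dirichlet_norm (nu : R) (f : disk -> C) : R :=
  sqrt (Series (dirichlet_term nu f)).

Definition composition_operator (phi : disk -> disk) (f : disk -> C) :
  disk -> C := fun z => f (phi z).

(** * Recurrence *)

(* [X] is a linear subspace of the functions on the disk, with norm [N]. *)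
Definition open_in (X : (disk -> C) -> Prop) (N : (disk -> C) -> R)
    (U : (disk -> C) -> Prop) : Prop :=
  (forall f, U f -> X f) /\
  (forall f, U f -> exists eps : R, 0 < eps /\
     forall g, X g -> N (fun z => g z - f z)%C < eps -> U g).

Definition recurrent (X : (disk -> C) -> Prop) (N : (disk -> C) -> R)
    (T : (disk -> C) -> (disk -> C)) : Prop :=
  forall U : (disk -> C) -> Prop,
    open_in X N U -> (exists f, U f) ->
    exists k : nat, (0 < k)%nat /\ exists f, U f /\ U (Nat.iter k T f).

(* Main.v *)
Require Import Defs.
From Stdlib Require Import Reals.
From Stdlib Require Import Lra Lia Psatz FunctionalExtensionality ClassicalEpsilon.
From Coquelicot Require Import Coquelicot.
Open Scope R_scope.

(** An automorphism of the disk has the form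
    [psi z = (lam z + p) / (1 + conj p lam z)] with [|lam| = 1] and [p = psi 0]
    ([disk_automorphism_normal_form]). A fixed point on the circle forces
    [|1 - lam| <= 2 |p|], and a second order linear recurrence then shows that
    [q = phi^k 0] satisfies
    [k^2 |p|^2 (1 - |q|^2) <= |q|^2 (1 - |p|^2)] ([orbit_escape]). Hence the orbit
    of 0 tends to the circle and never returns to the disk [|z| < |p|]. These
    two facts are all that is used about parabolic and hyperbolic maps.

    If [nu >= 1/2], a function of norm at most [A] satisfies
    [|f u - f v| <= A |u - v| / (1 - rho^2)] for [|u|, |v| <= rho]
    ([difference_bound]). Suppose that [f] and [f o phi^k] both lie in a small
    ball around the identity function. The increment of [f o phi^k] from 0 to a
    small [t > 0] is then close to [t]. On the other hand it is the increment of
    [f] between [phi^k 0] and [phi^k t], two points at distance about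
    [t (1 - |q|^2) <= t (1 - |p|^2)]; the deviation of [f] from the identity
    contributes only [O(eps t)], because the small distance compensates the
    factor [1 / (1 - rho^2)]. This is a contradiction ([not_recurrent]).

    If [nu < 1/2], the weights [(n + 1)^(2 nu)] are negligible with respect to
    [n + 1], so that a kernel [1 / (1 - v z)] has norm [o(1 / (1 - |v|^2))]
    ([kernel_small]). Say that [f] is approximately killed if, for every
    automorphism [psi] with [psi 0] close to the circle, some [x] close to [f] has
    [x o psi] close to 0. Such functions form a closed linear space. It contains
    the kernels: the composition of a kernel with [psi] is a constant plus a
    function of small norm, and the constant is removed by subtracting a
    multiple, itself of small norm, of a kernel whose pole is near the circle
    ([killed_kernel]). The kernels span a dense subspace, so every [f] is
    approximately killed ([killed_space]). Apply this to [psi = phi^k], giving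
    [x], and to [psi^-1], giving [y]; this is possible because
    [|psi^-1 0| = |psi 0|]. Then [g = x + y o psi^-1] is close to [f], and so is
    [g o phi^k = x o psi + y] ([recurrent_of_escape]). *)

(** * Taylor coefficients and the norm *)

(** Complex series are read through their real and imaginary parts, where the
    theory of real power series applies. *)
Lemma is_series_fst (a : nat -> C) (l : C) :
  @is_series C_AbsRing C_NormedModule a l -> is_series (fun n => fst (a n)) (fst l).
Proof.
  intros H. unfold is_series in *.
  apply filterlim_ext with (fun n => fst (sum_n a n : C)).
  - intros n. induction n as [|n IH].
    + now rewrite !sum_O.
    + rewrite !sum_Sn, <- IH. reflexivity.
  - eapply filterlim_comp; [exact H|].
    intros P [eps HP]. exists eps. intros y Hy. apply HP. apply Hy.
Qed.

Lemma is_series_snd (a : nat -> C) (l : C) :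
  @is_series C_AbsRing C_NormedModule a l -> is_series (fun n => snd (a n)) (snd l).
Proof.
  intros H. unfold is_series in *.
  apply filterlim_ext with (fun n => snd (sum_n a n : C)).
  - intros n. induction n as [|n IH].
    + now rewrite !sum_O.
    + rewrite !sum_Sn, <- IH. reflexivity.
  - eapply filterlim_comp; [exact H|].
    intros P [eps HP]. exists eps. intros y Hy. apply HP. apply Hy.
Qed.

Lemma is_pseries_of_series (a : nat -> C) (z l : C) :
  @is_series C_AbsRing C_NormedModule (fun n => (a n * z ^ n)%C) l ->
  @is_pseries C_AbsRing C_NormedModule a z l.
Proof.
  apply is_series_ext. intros n.
  exact (Cmult_comm _ _).
Qed.

Lemma series_of_is_pseries (a : nat -> C) (z l : C) :
  @is_pseries C_AbsRing C_NormedModule a z l ->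
  @is_series C_AbsRing C_NormedModule (fun n => (a n * z ^ n)%C) l.
Proof.
  apply is_series_ext. intros n.
  exact (Cmult_comm _ _).
Qed.

Lemma is_pseries_fst (a : nat -> C) (x : R) (l : C) :
  @is_pseries C_AbsRing C_NormedModule a (RtoC x) l ->
  is_pseries (fun n => fst (a n)) x (fst l).
Proof.
  intros H. apply series_of_is_pseries, is_series_fst in H.
  revert H. apply is_series_ext. intros n.
  rewrite pow_n_pow, <- RtoC_pow. unfold scal; simpl; unfold mult; simpl. ring.
Qed.

Lemma is_pseries_snd (a : nat -> C) (x : R) (l : C) :
  @is_pseries C_AbsRing C_NormedModule a (RtoC x) l ->
  is_pseries (fun n => snd (a n)) x (snd l).
Proof.
  intros H. apply series_of_is_pseries, is_series_snd in H.
  revert H. apply is_series_ext. intros n.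
  rewrite pow_n_pow, <- RtoC_pow. unfold scal; simpl; unfold mult; simpl. ring.
Qed.

(** Convergence at one nonzero point keeps the terms bounded there. *)
Lemma CV_radius_pos_of_is_pseries (a : nat -> R) (x l : R) :
  0 < x -> is_pseries a x l -> Rbar_lt 0 (CV_radius a).
Proof.
  intros Hx H.
  destruct (Rbar_lt_le_dec 0 (CV_radius a)) as [|H0]; [assumption|exfalso].
  apply (CV_disk_outside a x).
  - eapply Rbar_le_lt_trans; [exact H0|]. simpl. rewrite Rabs_pos_eq; lra.
  - apply ex_series_lim_0. exists l. revert H. apply is_series_ext.
    intros n. rewrite pow_n_pow. apply Rmult_comm.
Qed.

Lemma real_pseries_unique (a b : nat -> R) (F : R -> R) :
  (forall x, Rabs x < 1 -> is_pseries a x (F x)) ->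
  (forall x, Rabs x < 1 -> is_pseries b x (F x)) ->
  forall n, a n = b n.
Proof.
  intros Ha Hb n.
  assert (Hhalf : Rabs (1 / 2) < 1) by (rewrite Rabs_pos_eq; lra).
  apply PSeries_ext_recip.
  - eapply CV_radius_pos_of_is_pseries; [|exact (Ha _ Hhalf)]. lra.
  - eapply CV_radius_pos_of_is_pseries; [|exact (Hb _ Hhalf)]. lra.
  - exists (mkposreal 1 Rlt_0_1). intros x Hx.
    assert (Hx1 : Rabs x < 1).
    { change (Rabs (x - 0) < 1) in Hx. now rewrite Rminus_0_r in Hx. }
    rewrite (is_pseries_unique _ _ _ (Ha x Hx1)).
    now rewrite (is_pseries_unique _ _ _ (Hb x Hx1)).
Qed.

Definition real_point (x : R) (Hx : Rabs x < 1) : disk :=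
  exist _ (RtoC x) (eq_ind_r (fun r => r < 1) Hx (Cmod_R x)).

(** The restrictions of real and imaginary parts to the diameter [(-1, 1)] are
    real power series with the real and imaginary parts of the coefficients. *)
Lemma power_series_unique (f : disk -> C) (a b : nat -> C) :
  power_series_on_disk a f -> power_series_on_disk b f -> a = b.
Proof.
  intros Ha Hb. apply functional_extensionality. intros n.
  pose (F := fun x => match Rlt_dec (Rabs x) 1 with
                      | left H => f (real_point x H)
                      | right _ => RtoC 0 end).
  assert (HF : forall c, power_series_on_disk c f -> forall x, Rabs x < 1 ->
            @is_pseries C_AbsRing C_NormedModule c (RtoC x) (F x)).
  { intros c Hc x Hx. unfold F. destruct (Rlt_dec (Rabs x) 1) as [H|]; [|lra].
    exact (Hc (real_point x H)). }
  apply injective_projections.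
  - apply (real_pseries_unique (fun n => fst (a n)) (fun n => fst (b n)) (fun x => fst (F x)));
      intros x Hx; apply is_pseries_fst, HF; assumption.
  - apply (real_pseries_unique (fun n => snd (a n)) (fun n => snd (b n)) (fun x => snd (F x)));
      intros x Hx; apply is_pseries_snd, HF; assumption.
Qed.

(** Since [taylor] is chosen by [epsilon], uniqueness is what makes it compute. *)
Lemma taylor_spec (a : nat -> C) (f : disk -> C) :
  power_series_on_disk a f -> taylor f = a.
Proof.
  intros H. apply (power_series_unique f); [|exact H].
  unfold taylor. apply epsilon_spec. now exists a.
Qed.

Definition weight (nu : R) (n : nat) : R := Rpower (INR n + 1) (2 * nu).

Definition energy (nu : R) (a : nat -> C) (N : nat) : R :=
  sum_n (fun n => Cmod (a n) ^ 2 * weight nu n) N.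

(** A bound on the norm stated through partial sums: it provides membership in
    the space at the same time and reduces norm estimates to finite sums; see
    [norm_le_space] and [space_norm_le]. *)
Definition norm_le (nu : R) (f : disk -> C) (A : R) : Prop :=
  exists a, power_series_on_disk a f /\ forall N, energy nu a N <= A ^ 2.

Lemma weight_pos nu n : 0 < weight nu n.
Proof. apply exp_pos. Qed.

Lemma energy_term_ge_0 nu (a : nat -> C) n : 0 <= Cmod (a n) ^ 2 * weight nu n.
Proof. apply Rmult_le_pos; [apply pow2_ge_0|apply Rlt_le, weight_pos]. Qed.

Lemma sum_n_nonneg (u : nat -> R) N : (forall n, 0 <= u n) -> 0 <= sum_n u N.
Proof.
  intros H. induction N as [|N IH]; [rewrite sum_O; auto|].
  rewrite sum_Sn. apply Rplus_le_le_0_compat; auto.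
Qed.

Lemma sum_n_le (u v : nat -> R) N : (forall n, u n <= v n) -> sum_n u N <= sum_n v N.
Proof.
  intros H. induction N as [|N IH]; [rewrite !sum_O; auto|].
  rewrite !sum_Sn. apply Rplus_le_compat; auto.
Qed.

Lemma sum_n_Rplus (u v : nat -> R) N :
  sum_n (fun n => u n + v n) N = sum_n u N + sum_n v N.
Proof.
  induction N as [|N IH]; [now rewrite !sum_O|].
  rewrite !sum_Sn, IH. unfold plus; simpl. ring.
Qed.

Lemma sum_n_Rmult (c : R) (u : nat -> R) N :
  sum_n (fun n => c * u n) N = c * sum_n u N.
Proof.
  induction N as [|N IH]; [now rewrite !sum_O|].
  rewrite !sum_Sn, IH. unfold plus; simpl. ring.
Qed.

Lemma sum_n_incr (u : nat -> R) N : (forall n, 0 <= u n) -> sum_n u N <= sum_n u (S N).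
Proof. intros H. rewrite sum_Sn. unfold plus; simpl. specialize (H (S N)). lra. Qed.

Lemma sum_n_mono (u : nat -> R) i N :
  (forall n, 0 <= u n) -> sum_n u N <= sum_n u (i + N).
Proof.
  intros H. induction i as [|i IH]; simpl; [lra|].
  eapply Rle_trans; [exact IH|now apply sum_n_incr].
Qed.

Lemma norm_le_space nu f A : 0 <= A ->
  norm_le nu f A -> dirichlet_space nu f /\ dirichlet_norm nu f <= A.
Proof.
  intros HA [a [Ha HN]].
  assert (Hlim : ex_finite_lim_seq (energy nu a)).
  { apply ex_finite_lim_seq_incr with (A ^ 2); [|exact HN].
    intros n. apply sum_n_incr, energy_term_ge_0. }
  destruct Hlim as [l Hl].
  assert (Hser : is_series (dirichlet_term nu f) l).
  { unfold is_series. unfold dirichlet_term. rewrite (taylor_spec _ _ Ha). exact Hl. }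
  split; [split|].
  - now rewrite (taylor_spec _ _ Ha).
  - now exists l.
  - unfold dirichlet_norm. rewrite (is_series_unique _ _ Hser).
    rewrite <- (sqrt_pow2 A HA). apply sqrt_le_1_alt.
    apply (is_lim_seq_le (energy nu a) (fun _ => A ^ 2) l (A ^ 2) HN Hl).
    apply is_lim_seq_const.
Qed.

Lemma space_norm_le nu f : dirichlet_space nu f -> norm_le nu f (dirichlet_norm nu f).
Proof.
  intros [Ha Hs]. exists (taylor f). split; [exact Ha|]. intros N.
  assert (Hl := Series_correct _ Hs).
  assert (HN : forall n, energy nu (taylor f) n <= Series (dirichlet_term nu f)).
  { apply is_lim_seq_incr_compare; [exact Hl|].
    intros n. apply sum_n_incr, energy_term_ge_0. }
  unfold dirichlet_norm. rewrite pow2_sqrt; [apply HN|].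
  eapply Rle_trans; [|apply (HN 0%nat)]. apply sum_n_nonneg, energy_term_ge_0.
Qed.

Lemma norm_le_ext nu f g A : (forall z, f z = g z) -> norm_le nu f A -> norm_le nu g A.
Proof. intros H. now rewrite (functional_extensionality f g H). Qed.

Lemma norm_le_mono nu f A B : 0 <= A -> A <= B -> norm_le nu f A -> norm_le nu f B.
Proof.
  intros HA HAB [a [Ha HN]]. exists a. split; [exact Ha|]. intros N.
  apply Rle_trans with (A ^ 2); [apply HN|]. now apply pow_incr.
Qed.

(** Minkowski's inequality, from the termwise bound
    [(x + y)^2 <= (1 + B/A) x^2 + (1 + A/B) y^2], whose weights are optimal when
    the two norms are exactly [A] and [B]. *)
Lemma norm_le_plus nu f g A B : 0 < A -> 0 < B ->
  norm_le nu f A -> norm_le nu g B -> norm_le nu (fun z => f z + g z)%C (A + B).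
Proof.
  intros HA HB [a [Ha HNa]] [b [Hb HNb]].
  exists (fun n => a n + b n)%C. split.
  - intros z. exact (is_pseries_plus _ _ _ _ _ (Ha z) (Hb z)).
  - intros N.
    apply Rle_trans with
      ((1 + B / A) * energy nu a N + (1 + A / B) * energy nu b N).
    + unfold energy. rewrite <- !sum_n_Rmult, <- sum_n_Rplus. apply sum_n_le. intros n.
      rewrite <- !Rmult_assoc, <- Rmult_plus_distr_r.
      apply Rmult_le_compat_r; [apply Rlt_le, weight_pos|].
      set (x := Cmod (a n)). set (y := Cmod (b n)).
      apply Rle_trans with ((x + y) ^ 2).
      { apply pow_incr. split; [apply Cmod_ge_0|apply Cmod_triangle]. }
      assert (E : (1 + B / A) * x ^ 2 + (1 + A / B) * y ^ 2 - (x + y) ^ 2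
                  = (B * x - A * y) ^ 2 / (A * B)) by (field; lra).
      assert (0 <= (B * x - A * y) ^ 2 / (A * B)); [|lra].
      apply Rmult_le_pos; [apply pow2_ge_0|].
      apply Rlt_le, Rinv_0_lt_compat, Rmult_lt_0_compat; assumption.
    + replace ((A + B) ^ 2) with ((1 + B / A) * A ^ 2 + (1 + A / B) * B ^ 2) by (field; lra).
      assert (0 < B / A) by now apply Rdiv_lt_0_compat.
      assert (0 < A / B) by now apply Rdiv_lt_0_compat.
      apply Rplus_le_compat; apply Rmult_le_compat_l; auto; lra.
Qed.

Lemma norm_le_scal nu f A (c : C) :
  norm_le nu f A -> norm_le nu (fun z => c * f z)%C (Cmod c * A).
Proof.
  intros [a [Ha HN]]. exists (fun n => c * a n)%C. split.
  - intros z. apply (is_pseries_scal (K := C_AbsRing) (V := C_NormedModule) c).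
    + apply Cmult_comm.
    + apply Ha.
  - intros N. rewrite Rpow_mult_distr.
    apply Rle_trans with (Cmod c ^ 2 * energy nu a N).
    + right. unfold energy. rewrite <- sum_n_Rmult. apply sum_n_ext. intros n.
      match goal with |- ?x = ?y => change (@eq R x y) end. rewrite Cmod_mult. ring.
    + apply Rmult_le_compat_l; [apply pow2_ge_0|apply HN].
Qed.

Lemma norm_le_minus nu f g A B : 0 < A -> 0 < B ->
  norm_le nu f A -> norm_le nu g B -> norm_le nu (fun z => f z - g z)%C (A + B).
Proof.
  intros HA HB Hf Hg.
  apply norm_le_ext with (fun z => f z + (- (1)) * g z)%C; [intros z; ring|].
  apply norm_le_plus; auto.
  replace B with (Cmod (- (1)) * B) by (rewrite Cmod_m1; ring).
  now apply norm_le_scal.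
Qed.

Lemma dirichlet_norm_ge_0 nu f : 0 <= dirichlet_norm nu f.
Proof. apply sqrt_pos. Qed.

Lemma norm_le_of_lt nu f e :
  dirichlet_space nu f -> dirichlet_norm nu f < e -> norm_le nu f e.
Proof.
  intros Hf Hlt. apply norm_le_mono with (dirichlet_norm nu f).
  - apply dirichlet_norm_ge_0.
  - lra.
  - now apply space_norm_le.
Qed.

Lemma space_minus nu f g :
  dirichlet_space nu f -> dirichlet_space nu g -> dirichlet_space nu (fun z => f z - g z)%C.
Proof.
  intros Hf Hg.
  assert (H1 := dirichlet_norm_ge_0 nu f). assert (H2 := dirichlet_norm_ge_0 nu g).
  apply (norm_le_space _ _ ((dirichlet_norm nu f + 1) + (dirichlet_norm nu g + 1))); [lra|].
  apply norm_le_minus; [lra|lra| |]; apply norm_le_of_lt; auto; lra.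
Qed.

Lemma space_of_difference nu f g A : dirichlet_space nu f -> 0 < A ->
  norm_le nu (fun z => g z - f z)%C A -> dirichlet_space nu g.
Proof.
  intros Hf HA H. assert (H1 := dirichlet_norm_ge_0 nu f).
  apply (norm_le_space _ _ (A + (dirichlet_norm nu f + 1))); [lra|].
  apply norm_le_ext with (fun z => (g z - f z) + f z)%C; [intros z; ring|].
  apply norm_le_plus; [exact HA|lra|exact H|]. apply norm_le_of_lt; [exact Hf|lra].
Qed.

(** * Automorphisms in normal form *)

(** The map [z |-> (lam z + p) / (1 + conj p lam z)], with the denominator
    cleared; [p] is the image of the origin. *)
Definition mobius (lam p : C) (psi : disk -> disk) : Prop :=
  Cmod lam = 1 /\ Cmod p < 1 /\
  forall z : disk,
    (proj1_sig (psi z) * (1 + Cconj p * lam * proj1_sig z) = lam * proj1_sig z + p)%C.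

Lemma Cmod_sqr (z : C) : Cmod z ^ 2 = fst z ^ 2 + snd z ^ 2.
Proof. exact (Cmod2_alt z). Qed.

Lemma Cmod_lt_sqr (x y : C) : Cmod x ^ 2 < Cmod y ^ 2 -> Cmod x < Cmod y.
Proof.
  intros H. destruct (Rlt_le_dec (Cmod x) (Cmod y)) as [|Hle]; [assumption|].
  assert (Hy := Cmod_ge_0 y). nra.
Qed.

Lemma Cmod_sqr_lt_1 (z : C) : Cmod z < 1 -> 0 <= Cmod z ^ 2 < 1.
Proof. intros H. assert (Hz := Cmod_ge_0 z). nra. Qed.

Lemma Cmult_integral (x y : C) : (x * y = 0)%C -> x = 0%C \/ y = 0%C.
Proof.
  intros E. destruct (Ceq_dec x 0%C) as [|Hx]; [now left|].
  destruct (Ceq_dec y 0%C) as [|Hy]; [now right|].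
  now elim (Cmult_neq_0 x y Hx Hy).
Qed.

Lemma one_plus_neq_0 (x : C) : Cmod x < 1 -> (1 + x)%C <> 0%C.
Proof.
  intros H E. assert (Ex : x = (- (1))%C).
  { replace x with ((1 + x) - 1)%C by ring. rewrite E. ring. }
  rewrite Ex, Cmod_m1 in H. lra.
Qed.

Lemma one_minus_neq_0 (x : C) : Cmod x < 1 -> (1 - x)%C <> 0%C.
Proof. intros H. apply (one_plus_neq_0 (- x)). now rewrite Cmod_opp. Qed.

Lemma Cmod_mult_lt_1 (x y : C) : Cmod x < 1 -> Cmod y < 1 -> Cmod (x * y) < 1.
Proof.
  intros Hx Hy. rewrite Cmod_mult.
  assert (H1 := Cmod_ge_0 x). assert (H2 := Cmod_ge_0 y). nra.
Qed.

Lemma Cmod_unit_mult (lam x : C) : Cmod lam = 1 -> Cmod (lam * x) = Cmod x.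
Proof. intros H. rewrite Cmod_mult, H. ring. Qed.

Lemma mobius_denominator (lam p z : C) :
  Cmod lam = 1 -> Cmod p < 1 -> Cmod z < 1 -> (1 + Cconj p * lam * z)%C <> 0%C.
Proof.
  intros Hl Hp Hz. apply one_plus_neq_0. apply Cmod_mult_lt_1; [|exact Hz].
  rewrite Cmult_comm, Cmod_unit_mult, Cmod_conj; assumption.
Qed.

Lemma Cmod_eq_1_sqr (lam : C) : Cmod lam = 1 -> fst lam ^ 2 + snd lam ^ 2 = 1.
Proof. intros H. rewrite <- Cmod_sqr, H. ring. Qed.

(** The numerator and the denominator of the normal form preserve the Hermitian
    form [|y|^2 - |x|^2] up to a factor. *)
Lemma mobius_identity (lam p z : C) : Cmod lam = 1 ->
  Cmod (1 + Cconj p * lam * z) ^ 2 - Cmod (lam * z + p) ^ 2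
  = (1 - Cmod z ^ 2) * (1 - Cmod p ^ 2).
Proof.
  intros H%Cmod_eq_1_sqr. rewrite !Cmod_sqr.
  destruct lam as [l1 l2], p as [p1 p2], z as [z1 z2]. simpl in *.
  set (A := l1 * (l1 * 1) + l2 * (l2 * 1)) in *.
  transitivity (1 + A * (p1 ^ 2 + p2 ^ 2) * (z1 ^ 2 + z2 ^ 2)
                - A * (z1 ^ 2 + z2 ^ 2) - (p1 ^ 2 + p2 ^ 2)).
  - unfold A. ring.
  - rewrite H. ring.
Qed.

Lemma disk_eq (z w : disk) : proj1_sig z = proj1_sig w -> z = w.
Proof.
  destruct z as [z Hz], w as [w Hw]. simpl. intros E. subst w.
  f_equal. apply Classical_Prop.proof_irrelevance.
Qed.

Lemma mobius_exists (lam p : C) :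
  Cmod lam = 1 -> Cmod p < 1 -> exists psi, mobius lam p psi.
Proof.
  intros Hl Hp.
  assert (H : forall z : disk,
    Cmod ((lam * proj1_sig z + p) / (1 + Cconj p * lam * proj1_sig z)) < 1).
  { intros [z Hz]. simpl.
    assert (Hd := mobius_denominator lam p z Hl Hp Hz).
    rewrite Cmod_div by exact Hd. apply -> Rdiv_lt_1; [|now apply Cmod_gt_0].
    apply Cmod_lt_sqr. assert (E := mobius_identity lam p z Hl).
    apply Cmod_sqr_lt_1 in Hz. apply Cmod_sqr_lt_1 in Hp. nra. }
  exists (fun z => exist (fun w : C => Cmod w < 1) _ (H z)). split; [exact Hl|split; [exact Hp|]].
  intros z. simpl. field. apply mobius_denominator; auto. exact (proj2_sig z).
Qed.

(** Solving for [z] gives the parameters [conj lam] and [- conj lam p]. That the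
    inverse sends the origin as far out as the map itself is what lets one
    treat forward and backward iterates together. *)
Lemma mobius_inverse (lam p : C) (psi : disk -> disk) : mobius lam p psi ->
  exists psi' lam' p', mobius lam' p' psi' /\ Cmod p' = Cmod p /\
    forall z, psi' (psi z) = z.
Proof.
  intros [Hl [Hp H]].
  assert (HlC : (Cconj lam * lam = 1)%C).
  { rewrite Cmult_comm, <- Cmod2_conj, Hl. f_equal; ring. }
  assert (Hp' : Cmod (- Cconj lam * p) = Cmod p).
  { rewrite Cmod_mult, Cmod_opp, Cmod_conj, Hl. ring. }
  assert (Hl' : Cmod (Cconj lam) = 1) by now rewrite Cmod_conj.
  destruct (mobius_exists (Cconj lam) (- Cconj lam * p)) as [psi' Hpsi'];
    [exact Hl'|lra|].
  exists psi', (Cconj lam), (- Cconj lam * p)%C.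
  split; [exact Hpsi'|split; [exact Hp'|]].
  intros z. apply disk_eq. destruct Hpsi' as [_ [_ Hpsi']].
  specialize (Hpsi' (psi z)). specialize (H z).
  assert (Hd := mobius_denominator (Cconj lam) (- Cconj lam * p) (proj1_sig (psi z))
    Hl' ltac:(lra) (proj2_sig (psi z))).
  assert (Hd2 := mobius_denominator lam p (proj1_sig z) Hl Hp (proj2_sig z)).
  set (u := proj1_sig (psi' (psi z))) in *. set (v := proj1_sig (psi z)) in *.
  set (x := proj1_sig z) in *.
  assert (Ec : (Cconj (- Cconj lam * p) * Cconj lam = - Cconj p)%C).
  { rewrite Cmult_conj, Copp_conj, Cconj_conj.
    transitivity (- Cconj p * (Cconj lam * lam))%C; [ring|rewrite HlC; ring]. }
  rewrite Ec in *.
  assert (E : (u * (1 + - Cconj p * v) = x * (1 + - Cconj p * v))%C).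
  { rewrite Hpsi'.
    replace p with (v * (1 + Cconj p * lam * x) - lam * x)%C at 1 by (rewrite H; ring).
    transitivity ((Cconj lam * lam) * (x * (1 + - Cconj p * v)))%C; [ring|].
    rewrite HlC. ring. }
  replace u with (u * (1 + - Cconj p * v) / (1 + - Cconj p * v))%C by (field; exact Hd).
  rewrite E. field. exact Hd.
Qed.

(** The new parameters are read off the product of the matrices with rows
    [(lam, p)] and [(conj p lam, 1)], divided by its lower right entry [d]. *)
Lemma mobius_comp (lam p mu q : C) (psi chi : disk -> disk) :
  mobius lam p psi -> mobius mu q chi ->
  exists nu r, mobius nu r (fun z => psi (chi z)).
Proof.
  intros [Hl [Hp H]] [Hm [Hq K]].
  assert (Hd := mobius_denominator lam p q Hl Hp Hq).
  set (d := (1 + Cconj p * lam * q)%C) in *.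
  assert (HlC : (lam * Cconj lam = 1)%C).
  { rewrite <- Cmod2_conj, Hl. f_equal; ring. }
  assert (Hcd : Cconj d = (1 + p * Cconj lam * Cconj q)%C).
  { unfold d. rewrite Cplus_conj, !Cmult_conj, Cconj_conj. f_equal.
    unfold Cconj, RtoC; simpl. f_equal; ring. }
  assert (Hcd0 : Cconj d <> 0%C).
  { intros E. apply Hd. rewrite <- (Cconj_conj d), E. unfold Cconj, RtoC; simpl. f_equal; ring. }
  exists (lam * mu * Cconj d / d)%C, ((lam * q + p) / d)%C.
  split; [|split].
  - rewrite Cmod_div by exact Hd. rewrite !Cmod_mult, Cmod_conj, Hl, Hm.
    field. now apply Rgt_not_eq, Cmod_gt_0.
  - rewrite Cmod_div by exact Hd. apply -> Rdiv_lt_1; [|now apply Cmod_gt_0].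
    apply Cmod_lt_sqr. assert (E := mobius_identity lam p q Hl). fold d in E.
    apply Cmod_sqr_lt_1 in Hq. apply Cmod_sqr_lt_1 in Hp. nra.
  - intros z. specialize (K z). specialize (H (chi z)).
    assert (Hz := mobius_denominator mu q (proj1_sig z) Hm Hq (proj2_sig z)).
    set (u := proj1_sig (psi (chi z))) in *. set (v := proj1_sig (chi z)) in *.
    set (x := proj1_sig z) in *.
    set (e := (1 + Cconj q * mu * x)%C) in *.
    (* The equation of [psi], cleared of the denominator [e] of [chi]. *)
    assert (E : (u * (e + Cconj p * lam * (v * e)) = lam * (v * e) + p * e)%C).
    { transitivity ((u * (1 + Cconj p * lam * v)) * e)%C; [ring|]. rewrite H. ring. }
    rewrite K in E.
    replace (Cconj ((lam * q + p) / d) * (lam * mu * Cconj d / d) * x)%C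
      with ((lam * Cconj lam * Cconj q + Cconj p * lam) * mu * x / d)%C.
    2:{ rewrite Cdiv_conj by exact Hd. rewrite Cplus_conj, Cmult_conj. field. tauto. }
    rewrite HlC.
    replace (1 + (1 * Cconj q + Cconj p * lam) * mu * x / d)%C
      with ((e + Cconj p * lam * (mu * x + q)) / d)%C by (unfold e, d in *; field; exact Hd).
    transitivity ((u * (e + Cconj p * lam * (mu * x + q))) / d)%C; [field; exact Hd|].
    rewrite E, Hcd.
    transitivity ((lam * (mu * x + q) + p * (1 + (lam * Cconj lam) * Cconj q * mu * x)) / d)%C.
    + rewrite HlC. unfold e. field. exact Hd.
    + field. exact Hd.
Qed.

(** * From linear fractional maps to the normal form *)

Lemma lft_map_Some (phi : lft) (z w : C) :
  phi (Some z) = Some w ->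
  (lft_c phi * z + lft_d phi <> 0)%C /\
  (w * (lft_c phi * z + lft_d phi) = lft_a phi * z + lft_b phi)%C.
Proof.
  simpl. destruct (Ceq_dec _ _) as [|Hd]; [discriminate|].
  intros E. injection E as <-. split; [exact Hd|field; exact Hd].
Qed.

Lemma quadratic_limit (A B K : R) :
  (forall t, 0 <= t < 1 -> 0 < A + B * t + K * t ^ 2) -> 0 <= A + B + K.
Proof.
  intros H. destruct (Rle_lt_dec 0 (A + B + K)) as [|Hn]; [assumption|exfalso].
  set (e := - (A + B + K)) in *.
  set (M := Rabs B + 2 * Rabs K + e).
  assert (HB := Rabs_pos B). assert (HK := Rabs_pos K).
  assert (He : 0 < e) by (unfold e; lra).
  assert (HM : 0 < M) by (unfold M; lra).
  set (s := e / M).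
  assert (Hs : s * M = e) by (unfold s; field; lra).
  assert (Hs0 : 0 < s) by now apply Rdiv_lt_0_compat.
  assert (Hs1 : s <= 1).
  { apply Rmult_le_reg_r with M; [exact HM|]. rewrite Hs. unfold M. lra. }
  specialize (H (1 - s) ltac:(lra)).
  assert (HB1 : - B <= Rabs B) by (rewrite <- Rabs_Ropp; apply Rle_abs).
  assert (HK1 : - K <= Rabs K) by (rewrite <- Rabs_Ropp; apply Rle_abs).
  assert (HK2 := Rle_abs K).
  assert (A + B + K = - e) by (unfold e; ring).
  assert (E : A + B * (1 - s) + K * (1 - s) ^ 2
    = - e + s * (- B) + 2 * s * (- K) + s * s * K) by nra.
  assert (s * (- B) <= s * Rabs B) by (apply Rmult_le_compat_l; lra).
  assert (s * ((2 - s) * (- K)) <= s * ((2 - s) * Rabs K)) by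
    (apply Rmult_le_compat_l; [lra|apply Rmult_le_compat_l; lra]).
  assert (s * ((2 - s) * Rabs K) <= s * (2 * Rabs K)) by
    (apply Rmult_le_compat_l; [lra|apply Rmult_le_compat_r; lra]).
  assert (s * (Rabs B + 2 * Rabs K + e) = e) by exact Hs.
  nra.
Qed.

(** By continuity the circle is sent into the closed disk. A point of the circle
    sent inside the disk would have the same image as some point of the disk,
    against injectivity. *)
Lemma circle_to_circle (lam p gam : C) :
  (lam - p * gam <> 0)%C ->
  (forall z, Cmod z < 1 ->
    (1 + gam * z <> 0)%C /\ Cmod (lam * z + p) < Cmod (1 + gam * z)) ->
  (forall w, Cmod w < 1 -> exists z, Cmod z < 1 /\
    (w * (1 + gam * z) = lam * z + p)%C) ->
  forall z, Cmod z = 1 -> Cmod (lam * z + p) ^ 2 = Cmod (1 + gam * z) ^ 2.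
Proof.
  intros nondeg maps_in onto z Hz.
  assert (Hle : Cmod (lam * z + p) ^ 2 <= Cmod (1 + gam * z) ^ 2).
  { set (w := (lam * z)%C). set (v := (gam * z)%C).
    assert (H := quadratic_limit
      (1 - fst p ^ 2 - snd p ^ 2)
      (2 * (fst v - fst w * fst p - snd w * snd p))
      (fst v ^ 2 + snd v ^ 2 - fst w ^ 2 - snd w ^ 2)).
    rewrite !Cmod_sqr. simpl in *.
    match type of H with ?P -> _ => assert (HP : P) end.
    { intros t Ht.
      assert (Htz : Cmod (RtoC t * z) < 1) by (rewrite Cmod_mult, Cmod_R, Hz, Rabs_pos_eq; lra).
      destruct (maps_in _ Htz) as [_ Hlt].
      assert (Hge := Cmod_ge_0 (lam * (RtoC t * z) + p)).
      assert (Hsq : Cmod (lam * (RtoC t * z) + p) ^ 2 < Cmod (1 + gam * (RtoC t * z)) ^ 2) by nra.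
      replace (lam * (RtoC t * z))%C with (RtoC t * w)%C in Hsq by (unfold w; ring).
      replace (gam * (RtoC t * z))%C with (RtoC t * v)%C in Hsq by (unfold v; ring).
      rewrite !Cmod_sqr in Hsq. simpl in Hsq. nra. }
    specialize (H HP). nra. }
  destruct (Rle_lt_or_eq_dec _ _ Hle) as [Hlt|]; [exfalso|assumption].
  apply Cmod_lt_sqr in Hlt.
  assert (Hd : (1 + gam * z <> 0)%C).
  { apply Cmod_gt_0. eapply Rle_lt_trans; [apply Cmod_ge_0|exact Hlt]. }
  destruct (onto ((lam * z + p) / (1 + gam * z))%C) as [y [Hy Ey]].
  { rewrite Cmod_div by exact Hd. apply -> Rdiv_lt_1; [exact Hlt|now apply Cmod_gt_0]. }
  assert (E0 : ((z - y) * (lam - p * gam) = 0)%C).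
  { assert (E1 : ((lam * z + p) * (1 + gam * y) = (lam * y + p) * (1 + gam * z))%C).
    { rewrite <- Ey. field. exact Hd. }
    replace ((z - y) * (lam - p * gam))%C with
      ((lam * z + p) * (1 + gam * y) - (lam * y + p) * (1 + gam * z))%C by ring.
    rewrite E1. ring. }
  destruct (Cmult_integral _ _ E0) as [E|E]; [|now apply nondeg].
  assert (z = y) by (replace z with (z - y + y)%C by ring; rewrite E; ring).
  subst y. lra.
Qed.

Lemma normal_form_coefficients (lam p gam : C) :
  (lam - p * gam <> 0)%C ->
  (forall z, Cmod z < 1 ->
    (1 + gam * z <> 0)%C /\ Cmod (lam * z + p) < Cmod (1 + gam * z)) ->
  (forall w, Cmod w < 1 -> exists z, Cmod z < 1 /\
    (w * (1 + gam * z) = lam * z + p)%C) ->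
  Cmod p < 1 /\ Cmod lam = 1 /\ gam = (Cconj p * lam)%C.
Proof.
  intros nondeg maps_in onto.
  assert (Hp : Cmod p < 1).
  { destruct (maps_in 0%C) as [_ H]; [rewrite Cmod_0; lra|].
    replace (lam * 0 + p)%C with p in H by ring.
    replace (1 + gam * 0)%C with (RtoC 1) in H by ring. now rewrite Cmod_1 in H. }
  split; [exact Hp|].
  (* On the circle the identity of moduli reads
     |lam|^2 + |p|^2 + 2 Re (lam z conj p) = 1 + |gam|^2 + 2 Re (gam z);
     four points determine its coefficients. *)
  assert (H1 := circle_to_circle _ _ _ nondeg maps_in onto 1 Cmod_1).
  assert (H2 := circle_to_circle _ _ _ nondeg maps_in onto (- (1))%C Cmod_m1).
  assert (H3 := circle_to_circle _ _ _ nondeg maps_in onto Ci Cmod_Ci).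
  assert (H4 := circle_to_circle _ _ _ nondeg maps_in onto (- Ci)%C
    ltac:(rewrite Cmod_opp; exact Cmod_Ci)).
  apply Cmod_sqr_lt_1 in Hp.
  assert (Hl0 := Cmod_ge_0 lam).
  rewrite !Cmod_sqr in *.
  assert (Hl2 := Cmod_sqr lam).
  destruct lam as [l1 l2], p as [p1 p2], gam as [g1 g2]. simpl in *.
  assert (Eg1 : g1 = l1 * p1 + l2 * p2) by nra.
  assert (Eg2 : g2 = l2 * p1 - l1 * p2) by nra.
  split.
  - assert ((Cmod (l1, l2) ^ 2 - 1) * (1 - (p1 ^ 2 + p2 ^ 2)) = 0).
    { replace (Cmod (l1, l2) ^ 2) with (l1 ^ 2 + l2 ^ 2) by (simpl; lra).
      subst g1 g2. nra. }
    assert (Cmod (l1, l2) ^ 2 - 1 = 0) by nra. nra.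
  - rewrite Eg1, Eg2. unfold Cconj, Cmult; simpl. f_equal; ring.
Qed.

Lemma disk_automorphism_normal_form (phi : lft) : disk_automorphism phi ->
  exists lam p, Cmod lam = 1 /\ Cmod p < 1 /\ lft_d phi <> 0%C /\
    lft_a phi = (lam * lft_d phi)%C /\ lft_b phi = (p * lft_d phi)%C /\
    lft_c phi = (Cconj p * lam * lft_d phi)%C.
Proof.
  intros [Hin Honto].
  assert (Hmap : forall z, Cmod z < 1 -> exists w, Cmod w < 1 /\ phi (Some z) = Some w).
  { intros z Hz. specialize (Hin (Some z) Hz).
    destruct (phi (Some z)) as [w|]; [now exists w|destruct Hin]. }
  assert (Hd : lft_d phi <> 0%C).
  { destruct (Hmap 0%C) as [w [_ Hw]]; [rewrite Cmod_0; lra|].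
    apply lft_map_Some in Hw as [Hw _]. now rewrite Cmult_0_r, Cplus_0_l in Hw. }
  assert (Hdet := lft_det phi).
  set (a := lft_a phi) in *. set (b := lft_b phi) in *.
  set (c := lft_c phi) in *. set (d := lft_d phi) in *.
  destruct (normal_form_coefficients (a / d) (b / d) (c / d)) as [Hp [Hl Hg]].
  - intros E. apply Hdet.
    replace (a * d - b * c)%C with ((a / d - b / d * (c / d)) * (d * d))%C by (field; exact Hd).
    rewrite E. ring.
  - intros z Hz. destruct (Hmap z Hz) as [w [Hw E]].
    apply lft_map_Some in E as [Hn E]. fold a b c d in Hn, E.
    assert (Hn' : (1 + c / d * z <> 0)%C).
    { intros E0. apply Hn.
      replace (c * z + d)%C with ((1 + c / d * z) * d)%C by (field; exact Hd).
      rewrite E0. ring. }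
    split; [exact Hn'|].
    replace (a / d * z + b / d)%C with (w * (1 + c / d * z))%C.
    2:{ transitivity (w * (c * z + d) / d)%C; [field; exact Hd|].
        rewrite E. field. exact Hd. }
    rewrite Cmod_mult. apply Cmod_gt_0 in Hn'. nra.
  - intros w Hw. destruct (Honto (Some w) Hw) as [[z|] [Hz E]]; [|destruct Hz].
    exists z. split; [exact Hz|].
    apply lft_map_Some in E as [Hn E]. fold a b c d in Hn, E.
    transitivity (w * (c * z + d) / d)%C; [field; exact Hd|].
    rewrite E. field. exact Hd.
  - exists (a / d)%C, (b / d)%C. repeat split; auto.
    + field; exact Hd.
    + field; exact Hd.
    + rewrite <- Hg. field; exact Hd.
Qed.

Lemma mobius_disk_map (phi : lft) (Hphi : disk_automorphism phi) (lam p : C) :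
  Cmod lam = 1 -> Cmod p < 1 -> lft_d phi <> 0%C ->
  lft_a phi = (lam * lft_d phi)%C -> lft_b phi = (p * lft_d phi)%C ->
  lft_c phi = (Cconj p * lam * lft_d phi)%C ->
  mobius lam p (disk_map phi Hphi).
Proof.
  intros Hl Hp Hd Ha Hb Hc. split; [exact Hl|split; [exact Hp|]].
  intros z. assert (E := to_sphere_disk_map phi Hphi z). unfold to_sphere in E.
  symmetry in E. apply lft_map_Some in E as [_ E]. rewrite Ha, Hb, Hc in E.
  set (w := proj1_sig (disk_map phi Hphi z)) in *. set (x := proj1_sig z) in *.
  set (d := lft_d phi) in *.
  transitivity ((w * (Cconj p * lam * d * x + d)) / d)%C; [field; exact Hd|].
  rewrite E. field. exact Hd.
Qed.

(** On the circle [1 / z = conj z], and the fixed point equation reads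
    [1 - lam = p / z - conj p lam z]. *)
Lemma circle_fixed_point_bound (lam p z : C) : Cmod z = 1 ->
  (z * (1 + Cconj p * lam * z) = lam * z + p)%C -> Cmod lam = 1 ->
  Cmod (1 - lam) <= 2 * Cmod p.
Proof.
  intros Hz E Hl.
  assert (E' : ((1 - lam) * z = p - Cconj p * lam * z * z)%C).
  { transitivity (z * (1 + Cconj p * lam * z) - lam * z - Cconj p * lam * z * z)%C; [ring|].
    rewrite E. ring. }
  replace (Cmod (1 - lam)) with (Cmod ((1 - lam) * z)) by (rewrite Cmod_mult, Hz; ring).
  rewrite E'. unfold Cminus. eapply Rle_trans; [apply Cmod_triangle|].
  rewrite Cmod_opp, !Cmod_mult, Cmod_conj, Hl, Hz. lra.
Qed.

Lemma lft_map_Some_intro (phi : lft) (z w : C) :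
  (lft_c phi * z + lft_d phi <> 0)%C ->
  (w * (lft_c phi * z + lft_d phi) = lft_a phi * z + lft_b phi)%C ->
  phi (Some z) = Some w.
Proof.
  intros Hd E. simpl. destruct (Ceq_dec _ _) as [|_]; [contradiction|].
  rewrite <- E. f_equal. field. exact Hd.
Qed.

(** In the parabolic case the unique fixed point lies on the circle, since fixed
    points are exchanged by the reflection in the circle; and [p = 0] is excluded,
    as a rotation about 0 fixes both 0 and infinity. *)
Lemma non_elliptic (phi : lft) (lam p : C) :
  parabolic phi \/ hyperbolic phi ->
  Cmod lam = 1 -> Cmod p < 1 -> lft_d phi <> 0%C ->
  lft_a phi = (lam * lft_d phi)%C -> lft_b phi = (p * lft_d phi)%C ->
  lft_c phi = (Cconj p * lam * lft_d phi)%C ->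
  p <> 0%C /\ Cmod (1 - lam) <= 2 * Cmod p.
Proof.
  intros Htype Hl Hp Hd Ha Hb Hc.
  set (d := lft_d phi) in *.
  assert (Hl0 : lam <> 0%C) by (apply Cmod_gt_0; lra).
  assert (Hfix : forall z, phi (Some z) = Some z ->
            (z * (1 + Cconj p * lam * z) = lam * z + p)%C).
  { intros z E. apply lft_map_Some in E as [_ E]. rewrite Ha, Hb, Hc in E. fold d in E.
    transitivity ((z * (Cconj p * lam * d * z + d)) / d)%C; [field; exact Hd|].
    rewrite E. field. exact Hd. }
  assert (Hrot : p = 0%C -> phi None = None /\ forall z, phi (Some z) = Some (lam * z)%C).
  { intros ->.
    assert (Hc0 : lft_c phi = 0%C).
    { rewrite Hc. replace (Cconj 0) with (RtoC 0); [ring|].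
      unfold Cconj, RtoC; simpl. f_equal; ring. }
    split.
    - simpl. destruct (Ceq_dec _ _); [reflexivity|contradiction].
    - intros z. apply lft_map_Some_intro; rewrite Hc0; fold d.
      + intros E. apply Hd. rewrite <- E. ring.
      + rewrite Ha, Hb. ring. }
  destruct Htype as [[_ [_ [s [Hs Huniq]]]] | [_ [Hid [s1 [s2 [_ [Hc1 [_ [Hs1 _]]]]]]]]].
  - assert (Hp0 : p <> 0%C).
    { intros E. destruct (Hrot E) as [Hinf Hfin].
      assert (E1 := Huniq None Hinf).
      assert (E2 := Huniq (Some (RtoC 0)) ltac:(rewrite Hfin; f_equal; ring)).
      congruence. }
    split; [exact Hp0|].
    assert (Hcp0 : Cconj p <> 0%C).
    { apply Cmod_gt_0. rewrite Cmod_conj. now apply Cmod_gt_0. }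
    destruct s as [z|].
    2:{ exfalso. simpl in Hs. destruct (Ceq_dec _ _) as [E|]; [|discriminate].
        rewrite Hc in E.
        apply Cmult_integral in E as [E|E]; [|contradiction].
        apply Cmult_integral in E as [E|E]; contradiction. }
    assert (Ez := Hfix z Hs).
    (* [z'] is the second root of the fixed point equation. Uniqueness makes the
       root double, so its square is the product [- p / (Cconj p * lam)] of the
       roots, which has modulus 1. *)
    set (z' := (- (1 - lam) / (Cconj p * lam) - z)%C).
    assert (Ez' : (z' * (1 + Cconj p * lam * z') = lam * z' + p)%C).
    { transitivity (lam * z' + (z * (1 + Cconj p * lam * z) - lam * z))%C.
      - unfold z'. field. tauto.
      - rewrite Ez. ring. }
    assert (Hn' : (lft_c phi * z' + lft_d phi <> 0)%C).
    { intros E0. rewrite Hc in E0. fold d in E0.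
      assert (E1 : (1 + Cconj p * lam * z' = 0)%C).
      { transitivity ((Cconj p * lam * d * z' + d) / d)%C; [field; exact Hd|].
        rewrite E0. field. exact Hd. }
      rewrite E1 in Ez'.
      assert (E2 : (Cconj p * (lam * z') = - (1))%C).
      { transitivity ((1 + Cconj p * lam * z') - 1)%C; [ring|rewrite E1; ring]. }
      assert (E3 : (lam * z' = - p)%C).
      { transitivity ((lam * z' + p) - p)%C; [ring|rewrite <- Ez'; ring]. }
      rewrite E3 in E2.
      assert (E4 : Cmod (Cconj p * - p) = 1) by (rewrite E2; apply Cmod_m1).
      rewrite Cmod_mult, Cmod_opp, Cmod_conj in E4.
      assert (H0 := Cmod_ge_0 p). nra. }
    assert (E := Huniq (Some z') ltac:(apply lft_map_Some_intro; [exact Hn'|];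
       rewrite Ha, Hb, Hc; fold d;
       transitivity (z' * (1 + Cconj p * lam * z') * d)%C; [ring|rewrite Ez'; ring])).
    injection E as Ezz.
    apply (circle_fixed_point_bound lam p z); [|exact Ez|exact Hl].
    assert (Eprod : (Cconj p * (lam * (z * z)) = - p)%C).
    { rewrite Ezz at 2. unfold z'.
      transitivity (lam * z - z * (1 + Cconj p * lam * z))%C; [field; tauto|].
      rewrite Ez. ring. }
    assert (Em : Cmod (Cconj p * (lam * (z * z))) = Cmod p) by (rewrite Eprod; apply Cmod_opp).
    rewrite !Cmod_mult, Cmod_conj, Hl in Em.
    apply Cmod_gt_0 in Hp0. assert (Hz0 := Cmod_ge_0 z).
    assert (Cmod z * Cmod z = 1) by (apply Rmult_eq_reg_l with (Cmod p); lra).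
    nra.
  - destruct s1 as [z|]; [|destruct Hc1]. simpl in Hc1.
    split.
    + intros E. destruct (Hrot E) as [Hinf Hfin]. apply Hid.
      assert (El : lam = 1%C).
      { assert (Ez := Hfin z). rewrite Hs1 in Ez. injection Ez as Ez.
        assert (Hz : z <> 0%C) by (apply Cmod_gt_0; lra).
        replace lam with (lam * z / z)%C by (field; exact Hz).
        rewrite <- Ez. field. exact Hz. }
      intros [y|]; [|exact Hinf]. rewrite Hfin, El. f_equal. ring.
    + now apply (circle_fixed_point_bound lam p z); [|apply Hfix|].
Qed.

(** * The orbit of the origin *)

Definition origin : disk := exist (fun w : C => Cmod w < 1) 0%C
  (eq_ind_r (fun r => r < 1) Rlt_0_1 Cmod_0).

Lemma mobius_origin (lam p : C) (psi : disk -> disk) :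
  mobius lam p psi -> proj1_sig (psi origin) = p.
Proof.
  intros [_ [_ H]]. specialize (H origin). simpl in H.
  transitivity (proj1_sig (psi origin) * (1 + Cconj p * lam * 0))%C; [ring|].
  rewrite H. ring.
Qed.

Lemma mobius_id : mobius 1 0 (fun z => z).
Proof.
  split; [apply Cmod_1|split; [rewrite Cmod_0; lra|]].
  intros z. replace (Cconj 0) with (RtoC 0); [ring|].
  unfold Cconj, RtoC; simpl. f_equal; ring.
Qed.

Lemma mobius_iter (lam p : C) (psi : disk -> disk) (k : nat) :
  mobius lam p psi -> exists mu q, mobius mu q (Nat.iter k psi).
Proof.
  intros H. induction k as [|k [mu [q IH]]].
  - exists 1%C, 0%C. exact mobius_id.
  - exact (mobius_comp _ _ _ _ _ _ H IH).
Qed.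

(** Homogeneous coordinates of the orbit of 0: the last column of the [k]-th
    power of the matrix with rows [(lam, p)] and [(conj p lam, 1)]. *)
Fixpoint orbit_coords (lam p : C) (k : nat) : C * C :=
  match k with
  | 0%nat => (RtoC 0, RtoC 1)
  | S k => let (B, D) := orbit_coords lam p k in
           ((lam * B + p * D)%C, (D + Cconj p * lam * B)%C)
  end.

Lemma orbit_coords_spec (lam p : C) (psi : disk -> disk) (k : nat) :
  mobius lam p psi ->
  let (B, D) := orbit_coords lam p k in
  (proj1_sig (Nat.iter k psi origin) * D = B)%C /\
  Cmod D ^ 2 - Cmod B ^ 2 = (1 - Cmod p ^ 2) ^ k.
Proof.
  intros [Hl [Hp H]]. induction k as [|k IH]; cbn [orbit_coords].
  - simpl. rewrite Cmod_0, Cmod_1. split; [ring|ring].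
  - destruct (orbit_coords lam p k) as [B D]. destruct IH as [E Hk].
    specialize (H (Nat.iter k psi origin)).
    set (u := proj1_sig (psi (Nat.iter k psi origin))) in *.
    set (v := proj1_sig (Nat.iter k psi origin)) in *.
    split.
    + rewrite <- E. change (proj1_sig (Nat.iter (S k) psi origin)) with u.
      transitivity ((u * (1 + Cconj p * lam * v)) * D)%C; [ring|].
      rewrite H. ring.
    + transitivity ((1 - Cmod p ^ 2) * (Cmod D ^ 2 - Cmod B ^ 2)); [|now rewrite Hk].
      apply Cmod_eq_1_sqr in Hl.
      rewrite !Cmod_sqr. clear H E u v Hk Hp.
      destruct lam as [l1 l2], p as [p1 p2], B as [b1 b2], D as [d1 d2]. simpl in *.
      set (A := l1 * (l1 * 1) + l2 * (l2 * 1)) in *.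
      transitivity ((d1 ^ 2 + d2 ^ 2) * (1 - (p1 ^ 2 + p2 ^ 2))
         - A * (b1 ^ 2 + b2 ^ 2) * (1 - (p1 ^ 2 + p2 ^ 2))).
      * unfold A. ring.
      * rewrite Hl. ring.
Qed.

(** Cayley-Hamilton: the matrix has trace [1 + lam] and determinant
    [lam (1 - |p|^2)]. *)
Lemma orbit_coords_recurrence (lam p : C) (k : nat) : Cmod lam = 1 ->
  fst (orbit_coords lam p (S (S k))) =
  ((1 + lam) * fst (orbit_coords lam p (S k))
   - lam * RtoC (1 - Cmod p ^ 2) * fst (orbit_coords lam p k))%C.
Proof.
  intros Hl. simpl. destruct (orbit_coords lam p k) as [B D]. simpl fst.
  rewrite RtoC_minus.
  replace (RtoC (Cmod p * (Cmod p * 1))) with (p * Cconj p)%C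
    by (rewrite <- Cmod2_conj; reflexivity).
  ring.
Qed.

(** The hypothesis means that the trace has modulus at least [2 g], where [g^2] is
    the modulus of the determinant. After division by [g^k] the moduli of the
    first coordinates therefore form a convex sequence starting at 0, which
    grows at least linearly. *)
Lemma orbit_growth (lam p : C) : Cmod lam = 1 -> Cmod p < 1 ->
  Cmod (1 - lam) <= 2 * Cmod p ->
  let g := sqrt (1 - Cmod p ^ 2) in
  forall k, INR k * (Cmod p * g ^ k) <= Cmod (fst (orbit_coords lam p k)) * g.
Proof.
  intros Hl Hp Hell g.
  assert (Hp2 := Cmod_sqr_lt_1 p Hp).
  assert (Hg : 0 < g) by (apply sqrt_lt_R0; lra).
  assert (Hg2 : g ^ 2 = 1 - Cmod p ^ 2) by (apply pow2_sqrt; lra).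
  assert (Htr : 2 * g <= Cmod (1 + lam)).
  { assert (Hs : Cmod (1 + lam) ^ 2 = 4 - Cmod (1 - lam) ^ 2).
    { apply Cmod_eq_1_sqr in Hl. rewrite !Cmod_sqr. destruct lam; simpl in *. nra. }
    assert (Hm := Cmod_ge_0 (1 - lam)). assert (Hq := Cmod_ge_0 (1 + lam)). nra. }
  set (b := fun k => Cmod (fst (orbit_coords lam p k))).
  change (forall k, INR k * (Cmod p * g ^ k) <= b k * g).
  assert (Hrec : forall k, 2 * g * b (S k) <= b (S (S k)) + g ^ 2 * b k).
  { intros k.
    apply Rle_trans with (Cmod (1 + lam) * b (S k)).
    { apply Rmult_le_compat_r; [apply Cmod_ge_0|exact Htr]. }
    unfold b at 1. rewrite <- Cmod_mult.
    replace ((1 + lam) * fst (orbit_coords lam p (S k)))%C with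
      (fst (orbit_coords lam p (S (S k)))
        + lam * RtoC (1 - Cmod p ^ 2) * fst (orbit_coords lam p k))%C
      by (rewrite orbit_coords_recurrence by exact Hl; ring).
    eapply Rle_trans; [apply Cmod_triangle|].
    rewrite !Cmod_mult, Hl, Cmod_R, Rabs_pos_eq, <- Hg2 by lra. unfold b. lra. }
  assert (Hb0 : b 0%nat = 0) by (unfold b; simpl; apply Cmod_0).
  assert (Hb1 : b 1%nat = Cmod p).
  { unfold b; simpl. f_equal. ring. }
  (* [Hrec] says that the increments of [b k / g ^ k] are nondecreasing. *)
  assert (Hinc : forall k, g * b k + Cmod p * g ^ k <= b (S k)).
  { induction k as [|k IH]; [rewrite Hb0, Hb1; simpl; lra|].
    specialize (Hrec k).
    assert (g * (g * b k + Cmod p * g ^ k) <= g * b (S k)) by (apply Rmult_le_compat_l; lra).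
    simpl. simpl in Hrec. nra. }
  induction k as [|k IH]; [rewrite Hb0; simpl; lra|].
  rewrite S_INR. specialize (Hinc k). simpl.
  assert (g * (INR k * (Cmod p * g ^ k)) <= g * (b k * g)) by (apply Rmult_le_compat_l; lra).
  assert (g * (g * b k + Cmod p * g ^ k) <= g * b (S k)) by (apply Rmult_le_compat_l; lra).
  nra.
Qed.

(** In homogeneous coordinates [q = B / D], and the invariant form gives
    [|D|^2 - |B|^2 = (1 - |p|^2)^k]: a lower bound on [|B|] is an upper bound on
    [1 - |q|^2]. *)
Lemma orbit_escape (lam p : C) (psi : disk -> disk) (k : nat) :
  mobius lam p psi -> Cmod (1 - lam) <= 2 * Cmod p ->
  let q := proj1_sig (Nat.iter k psi origin) in
  INR k ^ 2 * Cmod p ^ 2 * (1 - Cmod q ^ 2) <= Cmod q ^ 2 * (1 - Cmod p ^ 2).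
Proof.
  intros H Hell q. assert (Hs := orbit_coords_spec lam p psi k H).
  destruct H as [Hl [Hp _]].
  assert (Hgr := orbit_growth lam p Hl Hp Hell k). simpl in Hgr.
  destruct (orbit_coords lam p k) as [B D]. fold q in Hs. simpl in Hgr.
  destruct Hs as [E Hk].
  assert (Hp2 := Cmod_sqr_lt_1 p Hp).
  assert (Hq2 := Cmod_sqr_lt_1 q (proj2_sig (Nat.iter k psi origin))).
  set (m := 1 - Cmod p ^ 2) in *.
  replace (1 - Cmod p * (Cmod p * 1)) with m in Hgr by (unfold m; ring).
  assert (Hm : 0 < m) by (unfold m; lra).
  set (g := sqrt m) in *.
  assert (Hg : 0 < g) by (apply sqrt_lt_R0; lra).
  assert (Hg2 : g ^ 2 = m) by (apply pow2_sqrt; lra).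
  assert (Hsq : (INR k * (Cmod p * g ^ k)) ^ 2 <= (Cmod B * g) ^ 2).
  { apply pow_incr. split; [|exact Hgr].
    apply Rmult_le_pos; [apply pos_INR|].
    apply Rmult_le_pos; [apply Cmod_ge_0|now apply pow_le, Rlt_le]. }
  assert (Hmk : (g ^ k) ^ 2 = m ^ k)
    by (rewrite <- pow_mult, Nat.mul_comm, pow_mult, Hg2; reflexivity).
  rewrite !Rpow_mult_distr, Hmk, Hg2 in Hsq.
  assert (Hmk0 : 0 < m ^ k) by now apply pow_lt.
  assert (HB : Cmod B ^ 2 * (1 - Cmod q ^ 2) = Cmod q ^ 2 * m ^ k).
  { rewrite <- Hk, <- E, Cmod_mult. ring. }
  apply Rmult_le_reg_r with (m ^ k); [exact Hmk0|].
  replace (Cmod q ^ 2 * m * m ^ k) with (Cmod B ^ 2 * m * (1 - Cmod q ^ 2))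
    by (transitivity (Cmod B ^ 2 * (1 - Cmod q ^ 2) * m); [ring|rewrite HB; ring]).
  replace (INR k ^ 2 * Cmod p ^ 2 * (1 - Cmod q ^ 2) * m ^ k)
    with (INR k ^ 2 * (Cmod p ^ 2 * m ^ k) * (1 - Cmod q ^ 2)) by ring.
  apply Rmult_le_compat_r; [lra|exact Hsq].
Qed.

(** * Kernels and monomials *)

Lemma sum_n_shift (u : nat -> R) N : sum_n u (S N) = u 0%nat + sum_n (fun n => u (S n)) N.
Proof.
  induction N as [|N IH]; [now rewrite sum_Sn, !sum_O|].
  rewrite sum_Sn, IH, (sum_Sn _ N). unfold plus; simpl. ring.
Qed.

Lemma geom_sum_le (r : R) N : 0 <= r < 1 -> sum_n (fun n => r ^ n) N <= / (1 - r).
Proof.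
  intros Hr.
  assert (E : (1 - r) * sum_n (fun n => r ^ n) N = 1 - r ^ S N).
  { induction N as [|N IH]; [rewrite sum_O; simpl; ring|].
    rewrite sum_Sn. unfold plus; simpl. simpl in IH.
    rewrite Rmult_plus_distr_l, IH. ring. }
  apply Rmult_le_reg_l with (1 - r); [lra|]. rewrite E, Rinv_r by lra.
  assert (0 <= r ^ S N) by (apply pow_le; lra). lra.
Qed.

(** The partial sum has the closed form
    [(1 - r^(N+1) (N + 2 - (N + 1) r)) / (1 - r)^2]. *)
Lemma arith_geom_sum_le (r : R) N : 0 <= r < 1 ->
  sum_n (fun n => (INR n + 1) * r ^ n) N <= / (1 - r) ^ 2.
Proof.
  intros Hr.
  assert (E : (1 - r) ^ 2 * sum_n (fun n => (INR n + 1) * r ^ n) N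
              = 1 - r ^ S N * (INR N + 2 - (INR N + 1) * r)).
  { induction N as [|N IH]; [rewrite sum_O; simpl; ring|].
    rewrite sum_Sn, S_INR. unfold plus; simpl. simpl in IH.
    rewrite Rmult_plus_distr_l, IH. ring. }
  assert (H2 : 0 < (1 - r) ^ 2) by (apply pow_lt; lra).
  apply Rmult_le_reg_l with ((1 - r) ^ 2); [lra|]. rewrite E, Rinv_r by lra.
  assert (Hk : 0 <= r ^ S N) by (apply pow_le; lra).
  assert (HN := pos_INR N).
  assert (0 <= r ^ S N * (INR N + 2 - (INR N + 1) * r)); [|lra].
  apply Rmult_le_pos; [exact Hk|nra].
Qed.

Lemma is_series_Cgeom (x : C) : Cmod x < 1 ->
  @is_series C_AbsRing C_NormedModule (fun n => (x ^ n)%C) (/ (1 - x))%C.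
Proof.
  intros Hx. assert (Hd := one_minus_neq_0 x Hx).
  assert (E : forall N, (@sum_n C_AbelianMonoid (fun n => (x ^ n)%C) N - / (1 - x)
    = x ^ S N * - / (1 - x))%C).
  { induction N as [|N IH].
    - rewrite sum_O. simpl. field. exact Hd.
    - rewrite sum_Sn.
      transitivity ((@sum_n C_AbelianMonoid (fun n => (x ^ n)%C) N - / (1 - x)) + x ^ S N)%C.
      + change plus with Cplus. ring.
      + rewrite IH. simpl. field. exact Hd. }
  apply (filterlim_locally_ball_norm (K := C_AbsRing) (U := C_NormedModule)).
  intros eps.
  assert (Hm := proj1 (Cmod_gt_0 _) Hd).
  destruct (pow_lt_1_zero (Cmod x) ltac:(rewrite Rabs_pos_eq; [exact Hx|apply Cmod_ge_0])
    (eps * Cmod (1 - x))) as [N HN].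
  { apply Rmult_lt_0_compat; [apply eps|exact Hm]. }
  exists N. intros n Hn.
  change (Cmod (@sum_n C_AbelianMonoid (fun n => (x ^ n)%C) n - / (1 - x)) < eps).
  rewrite E, Cmod_mult, Cmod_opp, Cmod_inv, Cmod_pow by exact Hd.
  specialize (HN (S n) ltac:(lia)). rewrite Rabs_pos_eq in HN by apply pow_le, Cmod_ge_0.
  apply Rmult_lt_reg_r with (Cmod (1 - x)); [exact Hm|].
  rewrite Rmult_assoc, Rinv_l by lra. lra.
Qed.

(** For [j = 0] these are the reproducing kernels of the Hardy space. The general
    [j] is closed under subtracting the leading Taylor term, and [v = 0] gives
    the monomials. *)
Definition kernel (j : nat) (v : C) (z : disk) : C :=
  (proj1_sig z ^ j / (1 - v * proj1_sig z))%C.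

Definition kernel_coef (j : nat) (v : C) : nat -> C :=
  @PS_incr_n C_AbsRing C_NormedModule (fun n => (v ^ n)%C) j.

Lemma power_series_kernel (j : nat) (v : C) : Cmod v < 1 ->
  power_series_on_disk (kernel_coef j v) (kernel j v).
Proof.
  intros Hv z. unfold kernel, kernel_coef.
  apply (is_pseries_incr_n (K := C_AbsRing) (V := C_NormedModule) (fun n => (v ^ n)%C) j).
  apply is_pseries_of_series.
  assert (H := is_series_Cgeom (v * proj1_sig z) (Cmod_mult_lt_1 _ _ Hv (proj2_sig z))).
  revert H. apply is_series_ext. intros n. apply Cpow_mult_l.
Qed.

(** Shifting the coefficients by [j] amounts to shifting the weights. *)
Lemma shifted_energy_le (a : nat -> C) (j N : nat) (w : nat -> R) :
  (forall n, 0 <= w n) ->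
  sum_n (fun n => Cmod (@PS_incr_n C_AbsRing C_NormedModule a j n) ^ 2 * w n) N
  <= sum_n (fun n => Cmod (a n) ^ 2 * w (j + n)%nat) N.
Proof.
  revert w N. induction j as [|j IH]; intros w N Hw; [simpl; lra|].
  assert (Hnn : forall n, 0 <= Cmod (a n) ^ 2 * w (S j + n)%nat)
    by (intros n; apply Rmult_le_pos; [apply pow2_ge_0|apply Hw]).
  destruct N as [|N].
  - rewrite !sum_O. eapply Rle_trans; [|apply Hnn]. right.
    change (Cmod 0 ^ 2 * w 0%nat = 0). rewrite Cmod_0. ring.
  - rewrite sum_n_shift.
    change (Cmod (@PS_incr_n C_AbsRing C_NormedModule a (S j) 0)) with (Cmod 0).
    rewrite Cmod_0. eapply Rle_trans; [|apply (sum_n_incr _ N Hnn)].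
    eapply Rle_trans; [|exact (IH (fun n => w (S n)) N (fun n => Hw (S n)))].
    rewrite pow_ne_zero, Rmult_0_l by discriminate. right. apply Rplus_0_l.
Qed.

Lemma kernel_monomial (n : nat) (z : disk) : kernel n 0 z = (proj1_sig z ^ n)%C.
Proof. unfold kernel. field. Qed.

Lemma norm_le_monomial nu (n : nat) :
  norm_le nu (fun z => (proj1_sig z ^ n)%C) (sqrt (weight nu n)).
Proof.
  apply (norm_le_ext _ _ _ _ (kernel_monomial n)).
  exists (kernel_coef n 0). split; [apply power_series_kernel; rewrite Cmod_0; lra|].
  intros N. rewrite pow2_sqrt by apply Rlt_le, weight_pos.
  eapply Rle_trans; [apply shifted_energy_le; intros m; apply Rlt_le, weight_pos|].
  right. induction N as [|N IH].
  - rewrite sum_O. simpl. rewrite Cmod_1, Nat.add_0_r. ring.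
  - rewrite sum_Sn, IH. cbn [Cpow]. rewrite Cmult_0_l, Cmod_0. unfold plus; simpl. ring.
Qed.

Lemma kernel_coef_0 (n k : nat) : kernel_coef n 0 k = if Nat.eq_dec k n then RtoC 1 else RtoC 0.
Proof.
  unfold kernel_coef. revert k. induction n as [|n IH]; intros [|k].
  - reflexivity.
  - simpl. apply Cmult_0_l.
  - reflexivity.
  - change (@PS_incr_n C_AbsRing C_NormedModule (fun m => (0 ^ m)%C) n k
      = if Nat.eq_dec (S k) (S n) then RtoC 1 else RtoC 0).
    rewrite IH. destruct (Nat.eq_dec k n), (Nat.eq_dec (S k) (S n)); auto; lia.
Qed.

(** * Failure of recurrence for large weights *)

Lemma Cmod_pow_diff (u v : C) (rho : R) (n : nat) :
  Cmod u <= rho -> Cmod v <= rho ->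
  Cmod (u ^ n - v ^ n) <= INR n * rho ^ (pred n) * Cmod (u - v).
Proof.
  intros Hu Hv.
  assert (Hrho : 0 <= rho) by (eapply Rle_trans; [apply Cmod_ge_0|exact Hu]).
  assert (Hd := Cmod_ge_0 (u - v)).
  induction n as [|n IH].
  - simpl. replace (1 - 1)%C with (RtoC 0) by ring. rewrite Cmod_0. lra.
  - rewrite S_INR. simpl pred. cbn [Cpow].
    replace (u * u ^ n - v * v ^ n)%C with (u * (u ^ n - v ^ n) + (u - v) * v ^ n)%C by ring.
    eapply Rle_trans; [apply Cmod_triangle|]. rewrite !Cmod_mult, Cmod_pow.
    assert (Hvn : Cmod v ^ n <= rho ^ n) by (apply pow_incr; split; [apply Cmod_ge_0|exact Hv]).
    assert (H1 : Cmod u * Cmod (u ^ n - v ^ n) <= rho * (INR n * rho ^ pred n * Cmod (u - v))).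
    { apply Rmult_le_compat; auto using Cmod_ge_0. }
    assert (H2 : rho * (INR n * rho ^ pred n) = INR n * rho ^ n).
    { destruct n as [|m]; [simpl; ring|]. simpl pred. simpl pow. ring. }
    assert (H3 : Cmod (u - v) * Cmod v ^ n <= Cmod (u - v) * rho ^ n)
      by (apply Rmult_le_compat_l; assumption).
    replace (rho * (INR n * rho ^ pred n * Cmod (u - v))) with
      (INR n * rho ^ n * Cmod (u - v)) in H1 by (rewrite <- H2; ring).
    lra.
Qed.

Lemma is_series_Cmod_le (a : nat -> C) (l : C) (M : R) :
  @is_series C_AbsRing C_NormedModule a l ->
  (forall N, Cmod (@sum_n C_AbelianMonoid a N) <= M) -> Cmod l <= M.
Proof.
  intros Hl HM.
  apply (is_lim_seq_le (fun N => Cmod (@sum_n C_AbelianMonoid a N)) (fun _ => M) (Cmod l) M HM).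
  - apply (filterlim_comp _ _ _ _ (@norm C_AbsRing C_NormedModule) _ (locally l) _ Hl).
    exact (filterlim_norm (K := C_AbsRing) (V := C_NormedModule) l).
  - apply is_lim_seq_const.
Qed.

Lemma Cmod_sum_n_le (a : nat -> C) N :
  Cmod (@sum_n C_AbelianMonoid a N) <= sum_n (fun n => Cmod (a n)) N.
Proof.
  induction N as [|N IH]; [rewrite !sum_O; lra|].
  rewrite !sum_Sn. eapply Rle_trans; [apply Cmod_triangle|].
  now apply Rplus_le_compat_r.
Qed.

Lemma weight_ge_linear nu n : 1 / 2 <= nu -> INR n + 1 <= weight nu n.
Proof.
  intros Hnu. assert (Hn := pos_INR n). unfold weight.
  rewrite <- (Rpower_1 (INR n + 1)) at 1 by lra.
  apply Rle_Rpower; lra.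
Qed.

(** Termwise [|u^n - v^n| <= n rho^(n-1) |u - v|]; as the weights are at least
    [n + 1], Cauchy-Schwarz (in the form of AM-GM) leaves the sum of
    [n rho^(2n-2)], which is at most [1 / (1 - rho^2)^2]. *)
Lemma difference_bound nu f A rho (u v : disk) : 1 / 2 <= nu -> 0 < A ->
  norm_le nu f A -> rho < 1 ->
  Cmod (proj1_sig u) <= rho -> Cmod (proj1_sig v) <= rho ->
  Cmod (f u - f v) <= A * Cmod (proj1_sig u - proj1_sig v) / (1 - rho ^ 2).
Proof.
  intros Hnu HA [a [Ha HN]] Hrho Hu Hv.
  assert (Hrho0 : 0 <= rho) by (eapply Rle_trans; [apply Cmod_ge_0|exact Hu]).
  assert (Hd := Cmod_ge_0 (proj1_sig u - proj1_sig v)).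
  set (x := proj1_sig u) in *. set (y := proj1_sig v) in *.
  assert (Hr : 0 <= rho ^ 2 < 1) by nra.
  set (m := 1 - rho ^ 2).
  assert (Hm : 0 < m) by (unfold m; lra).
  (* The weights in this AM-GM inequality make both halves sum to [A / (2 m)]. *)
  assert (Hterm : forall n, Cmod (a n) * (INR n * rho ^ pred n) <=
     / (2 * A * m) * (Cmod (a n) ^ 2 * weight nu n) + A * m / 2 * (INR n * (rho ^ 2) ^ pred n)).
  { intros n. assert (Hn := pos_INR n).
    apply Rle_trans with
      (/ (2 * A * m) * (Cmod (a n) ^ 2 * INR n) + A * m / 2 * (INR n * (rho ^ 2) ^ pred n)).
    - rewrite <- pow_mult, Nat.mul_comm, pow_mult.
      set (c := Cmod (a n)). set (s := rho ^ pred n).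
      assert (E : / (2 * A * m) * (c ^ 2 * INR n) + A * m / 2 * (INR n * s ^ 2) - c * (INR n * s)
        = INR n * (c - A * m * s) ^ 2 / (2 * A * m)) by (field; lra).
      assert (0 <= INR n * (c - A * m * s) ^ 2 / (2 * A * m)); [|lra].
      apply Rmult_le_pos; [apply Rmult_le_pos; [exact Hn|apply pow2_ge_0]|].
      apply Rlt_le, Rinv_0_lt_compat. nra.
    - apply Rplus_le_compat_r, Rmult_le_compat_l.
      + apply Rlt_le, Rinv_0_lt_compat. nra.
      + apply Rmult_le_compat_l; [apply pow2_ge_0|].
        assert (H := weight_ge_linear nu n Hnu). lra. }
  assert (Hgeom : forall N, sum_n (fun n => INR n * (rho ^ 2) ^ pred n) N <= / m ^ 2).
  { intros [|N].
    - rewrite sum_O. simpl. rewrite Rmult_0_l. apply Rlt_le, Rinv_0_lt_compat. nra.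
    - rewrite sum_n_shift. simpl INR at 1. rewrite Rmult_0_l, Rplus_0_l.
      eapply Rle_trans; [|apply (arith_geom_sum_le (rho ^ 2) N Hr)].
      right. apply sum_n_ext. intros n. rewrite S_INR. reflexivity. }
  assert (Hsum : forall N, sum_n (fun n => Cmod (a n) * (INR n * rho ^ pred n)) N <= A / m).
  { intros N.
    eapply Rle_trans; [apply sum_n_le; exact Hterm|].
    rewrite sum_n_Rplus, !sum_n_Rmult.
    apply Rle_trans with (/ (2 * A * m) * A ^ 2 + A * m / 2 * / m ^ 2).
    - apply Rplus_le_compat; apply Rmult_le_compat_l.
      + apply Rlt_le, Rinv_0_lt_compat. nra.
      + apply HN.
      + nra.
      + apply Hgeom.
    - right. field. lra. }
  apply (is_series_Cmod_le (fun n => a n * x ^ n - a n * y ^ n)%C).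
  - apply (is_series_minus (K := C_AbsRing) (V := C_NormedModule));
      apply series_of_is_pseries, Ha.
  - intros N. eapply Rle_trans; [apply Cmod_sum_n_le|].
    apply Rle_trans with (sum_n (fun n => Cmod (x - y) * (Cmod (a n) * (INR n * rho ^ pred n))) N).
    + apply sum_n_le. intros n.
      replace (a n * x ^ n - a n * y ^ n)%C with (a n * (x ^ n - y ^ n))%C by ring.
      rewrite Cmod_mult. assert (H := Cmod_pow_diff x y rho n Hu Hv).
      assert (H0 := Cmod_ge_0 (a n)).
      apply (Rmult_le_compat_l _ _ _ H0) in H. lra.
    + rewrite sum_n_Rmult.
      replace (A * Cmod (x - y) / m) with (Cmod (x - y) * (A / m)) by (field; lra).
      apply Rmult_le_compat_l; [exact Hd|apply Hsum].
Qed.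

Lemma iter_composition_operator (psi : disk -> disk) (f : disk -> C) (k : nat) (z : disk) :
  Nat.iter k (composition_operator psi) f z = f (Nat.iter k psi z).
Proof.
  revert z. induction k as [|k IH]; intros z; [reflexivity|].
  change (Nat.iter k (composition_operator psi) f (psi z) = f (Nat.iter (S k) psi z)).
  now rewrite IH, Nat.iter_succ_r.
Qed.

(** The radius of the ball is kept strictly above a bound of the distance, so that
    the triangle inequality leaves room for a smaller ball. *)
Lemma ball_open nu (f : disk -> C) (r : R) :
  open_in (dirichlet_space nu) (dirichlet_norm nu)
    (fun g => dirichlet_space nu g /\ exists A, 0 < A < r /\ norm_le nu (fun z => g z - f z)%C A).
Proof.
  split; [now intros g [Hg _]|].
  intros g [Hg [A [HA Hn]]]. exists ((r - A) / 2). split; [lra|].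
  intros h Hh Hlt. split; [exact Hh|].
  exists (A + (r - A) / 2). split; [lra|].
  apply norm_le_ext with (fun z => (g z - f z) + (h z - g z))%C; [intros z; ring|].
  apply norm_le_plus; [lra|lra|exact Hn|].
  apply norm_le_of_lt; [now apply space_minus|exact Hlt].
Qed.

(** Near the origin an automorphism contracts distances by the factor
    [1 - |q|^2]. *)
Lemma mobius_displacement (lam q : C) (psi : disk -> disk) (z : disk) :
  mobius lam q psi ->
  (proj1_sig (psi z) - q = lam * proj1_sig z * RtoC (1 - Cmod q ^ 2)
      / (1 + Cconj q * lam * proj1_sig z))%C.
Proof.
  intros [Hl [Hq H]]. specialize (H z).
  assert (Hd := mobius_denominator lam q (proj1_sig z) Hl Hq (proj2_sig z)).
  set (x := proj1_sig z) in *. set (u := proj1_sig (psi z)) in *.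
  replace (RtoC (1 - Cmod q ^ 2)) with (1 - q * Cconj q)%C
    by (rewrite RtoC_minus, <- Cmod2_conj; reflexivity).
  transitivity ((u * (1 + Cconj q * lam * x)) / (1 + Cconj q * lam * x) - q)%C; [field; exact Hd|].
  rewrite H. field. exact Hd.
Qed.

Lemma mobius_modulus (lam q : C) (psi : disk -> disk) (z : disk) :
  mobius lam q psi ->
  (1 - Cmod (proj1_sig (psi z)) ^ 2) * Cmod (1 + Cconj q * lam * proj1_sig z) ^ 2
  = (1 - Cmod (proj1_sig z) ^ 2) * (1 - Cmod q ^ 2).
Proof.
  intros [Hl [Hq H]]. specialize (H z).
  rewrite <- (mobius_identity lam q (proj1_sig z) Hl), <- H, Cmod_mult. ring.
Qed.

(** With [t = m / 4], the ball of radius [t / 2] around the identity function is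
    disjoint from its inverse images under all powers of the operator: a function
    in the ball varies too little between the images of 0 and [t] under an
    iterate of [psi]. *)
Lemma not_recurrent nu (psi : disk -> disk) (m : R) : 1 / 2 <= nu -> 0 < m <= 1 ->
  (forall k, (0 < k)%nat -> exists lam q, mobius lam q (Nat.iter k psi) /\ m <= Cmod q ^ 2) ->
  ~ recurrent (dirichlet_space nu) (dirichlet_norm nu) (composition_operator psi).
Proof.
  intros Hnu Hm Hfar Hrec.
  set (t := m / 4).
  assert (Ht : 0 < t <= 1 / 4) by (unfold t; lra).
  destruct (Hrec _ (ball_open nu (fun z => proj1_sig z) (t / 2)))
    as [k [Hk [f [[Hf [A [HA Hn]]] [Hf' [A' [HA' Hn']]]]]]].
  { exists (fun z => proj1_sig z). split.
    - eapply norm_le_space; [|eapply norm_le_ext; [|apply (norm_le_monomial nu 1)]].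
      + apply sqrt_pos.
      + intros z. apply Cpow_1_r.
    - exists (t / 4). split; [lra|].
      apply norm_le_mono with (Cmod 0 * sqrt (weight nu 1)).
      + rewrite Cmod_0. lra.
      + rewrite Cmod_0. lra.
      + eapply norm_le_ext; [|apply norm_le_scal, (norm_le_monomial nu 1)].
        intros z. simpl. ring. }
  destruct (Hfar k Hk) as [lam [q [Hmob Hq]]].
  assert (Htd : Cmod (RtoC t) < 1) by (rewrite Cmod_R, Rabs_pos_eq; lra).
  set (z := exist (fun w : C => Cmod w < 1) (RtoC t) Htd : disk).
  set (chi := Nat.iter k psi) in *.
  set (h := fun z => (f z - proj1_sig z)%C) in *.
  set (h' := fun z => (Nat.iter k (composition_operator psi) f z - proj1_sig z)%C) in *.
  assert (Ho : proj1_sig (chi origin) = q) by exact (mobius_origin _ _ _ Hmob).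
  assert (Hdisp := mobius_displacement lam q chi z Hmob).
  assert (Hmodu := mobius_modulus lam q chi z Hmob).
  assert (Hl : Cmod lam = 1) by apply Hmob.
  assert (Hq1 : Cmod q < 1) by apply Hmob.
  assert (Hq2 := Cmod_sqr_lt_1 q Hq1).
  assert (Hden := mobius_denominator lam q (RtoC t) Hl Hq1 Htd).
  simpl proj1_sig in *.
  set (den := (1 + Cconj q * lam * RtoC t)%C) in *.
  set (u := proj1_sig (chi z)) in *.
  assert (Hx : Cmod (Cconj q * lam * RtoC t) <= t).
  { rewrite !Cmod_mult, Cmod_conj, Hl, Cmod_R, Rabs_pos_eq by lra.
    assert (H0 := Cmod_ge_0 q). nra. }
  assert (Hden1 : Cmod den <= 1 + t).
  { unfold den. eapply Rle_trans; [apply Cmod_triangle|]. rewrite Cmod_1. lra. }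
  assert (Hden2 : 1 - t <= Cmod den).
  { assert (H := Cmod_triangle den (- (Cconj q * lam * RtoC t))).
    rewrite Cmod_opp in H. replace (den + - (Cconj q * lam * RtoC t))%C with (RtoC 1) in H
      by (unfold den; ring). rewrite Cmod_1 in H. lra. }
  rewrite Cmod_R, (Rabs_pos_eq t) in Hmodu by lra.
  set (s := 1 - Cmod q ^ 2) in *.
  assert (Hs : 0 < s <= 1 - m) by (unfold s; lra).
  assert (Hdist : Cmod (u - q) * Cmod den = t * s).
  { rewrite Hdisp, Cmod_div by exact Hden.
    rewrite !Cmod_mult, Hl, !Cmod_R, !Rabs_pos_eq by lra.
    apply Cmod_gt_0 in Hden. field. lra. }
  assert (Hu0 := Cmod_ge_0 (u - q)).
  assert (Hdist' : Cmod (u - q) * (1 - t) <= t * s).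
  { rewrite <- Hdist. now apply Rmult_le_compat_l. }
  (* [rho] is chosen so that [u] and [q] have modulus at most [rho] while
     [1 - rho^2] is still comparable to [1 - |q|^2]. *)
  set (rho := sqrt (1 - s * (1 - t) / (1 + t))).
  assert (Hc : 0 < s * (1 - t) / (1 + t) <= s).
  { assert (E : s * (1 - t) / (1 + t) * (1 + t) = s * (1 - t)) by (field; lra).
    split; [apply Rdiv_lt_0_compat; nra|].
    apply Rmult_le_reg_r with (1 + t); [lra|]. rewrite E. nra. }
  set (c := s * (1 - t) / (1 + t)) in *.
  assert (Hrho2 : rho ^ 2 = 1 - c) by (apply pow2_sqrt; unfold s in *; lra).
  assert (Hrho0 : 0 <= rho) by apply sqrt_pos.
  assert (Hqrho : Cmod q <= rho).
  { assert (H0 := Cmod_ge_0 q). unfold s in *. nra. }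
  assert (Hurho : Cmod u <= rho).
  { assert (H0 := Cmod_ge_0 u).
    assert (Hu2 : Cmod u ^ 2 < 1) by (apply Cmod_sqr_lt_1; exact (proj2_sig (chi z))).
    assert (c <= 1 - Cmod u ^ 2); [|nra].
    apply Rmult_le_reg_r with ((1 + t) ^ 2); [nra|].
    replace (c * (1 + t) ^ 2) with ((1 - t ^ 2) * s) by (unfold c; field; lra).
    rewrite <- Hmodu. apply Rmult_le_compat_l; [lra|].
    apply pow_incr. split; [apply Cmod_ge_0|exact Hden1]. }
  assert (HD1 := difference_bound nu h A rho (chi z) (chi origin) Hnu (proj1 HA) Hn
    ltac:(nra) Hurho ltac:(rewrite Ho; exact Hqrho)).
  assert (HD2 := difference_bound nu h' A' t z origin Hnu (proj1 HA') Hn'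
    ltac:(lra) ltac:(simpl; rewrite Cmod_R, Rabs_pos_eq; lra) ltac:(simpl; rewrite Cmod_0; lra)).
  rewrite Ho, Hrho2 in HD1. fold u in HD1.
  simpl proj1_sig in HD2. replace (RtoC t - 0)%C with (RtoC t) in HD2 by ring.
  rewrite Cmod_R, (Rabs_pos_eq t) in HD2 by lra.
  (* The increment of [f o chi] from 0 to [t], computed in two ways. *)
  assert (E : (RtoC t = (u - q) + (h (chi z) - h (chi origin)) - (h' z - h' origin))%C).
  { unfold h, h'. rewrite !iter_composition_operator. fold chi. rewrite Ho. fold u.
    simpl proj1_sig. ring. }
  assert (Htri : t <= Cmod (u - q) + Cmod (h (chi z) - h (chi origin)) + Cmod (h' z - h' origin)).
  { replace t with (Cmod (RtoC t)) at 1 by (rewrite Cmod_R, Rabs_pos_eq; lra).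
    rewrite E. unfold Cminus at 1. eapply Rle_trans; [apply Cmod_triangle|].
    rewrite Cmod_opp. apply Rplus_le_compat_r, Cmod_triangle. }
  (* The three terms add up to at most (t - 3 t^2) + (10/9) t^2 + (8/15) t^2 < t. *)
  assert (B1 : Cmod (u - q) <= t - 3 * t ^ 2).
  { apply Rmult_le_reg_r with (1 - t); [lra|].
    eapply Rle_trans; [exact Hdist'|]. unfold t in *. nra. }
  assert (B2 : Cmod (h (chi z) - h (chi origin)) <= t / 2 * t * (20 / 9)).
  { eapply Rle_trans; [exact HD1|].
    replace (1 - (1 - c)) with c by ring.
    apply Rmult_le_reg_r with c; [lra|].
    replace (A * Cmod (u - q) / c * c) with (A * Cmod (u - q)) by (field; lra).
    apply Rle_trans with (t / 2 * Cmod (u - q)); [apply Rmult_le_compat_r; lra|].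
    replace (t / 2 * t * (20 / 9) * c) with (t / 2 * (t * (20 / 9) * c)) by ring.
    apply Rmult_le_compat_l; [lra|].
    apply Rmult_le_reg_r with ((1 - t) * (1 + t)); [nra|].
    replace (t * (20 / 9) * c * ((1 - t) * (1 + t))) with
      (t * s * (20 / 9 * (1 - t) ^ 2)) by (unfold c; field; lra).
    rewrite <- Rmult_assoc.
    apply Rle_trans with (t * s * (1 + t)); [apply Rmult_le_compat_r; lra|].
    apply Rmult_le_compat_l; nra. }
  assert (B3 : Cmod (h' z - h' origin) <= t / 2 * t * (16 / 15)).
  { eapply Rle_trans; [exact HD2|].
    apply Rmult_le_reg_r with (1 - t ^ 2); [nra|].
    replace (A' * t / (1 - t ^ 2) * (1 - t ^ 2)) with (A' * t) by (field; nra).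
    apply Rle_trans with (t / 2 * t); [apply Rmult_le_compat_r; lra|].
    rewrite Rmult_assoc. rewrite <- (Rmult_1_r (t / 2 * t)) at 1.
    apply Rmult_le_compat_l; nra. }
  nra.
Qed.

(** * Recurrence for small weights *)

(** Split at [x = exp (ln eps / (2 nu - 1))], beyond which
    [x^(2 nu - 1) <= eps]; below it the weight is at most [x]. *)
Lemma weight_sublinear nu eps : nu < 1 / 2 -> 0 < eps ->
  exists K, 0 < K /\ forall n, weight nu n <= eps * (INR n + 1) + K.
Proof.
  intros Hnu Heps. set (s := 2 * nu - 1). assert (Hs : s < 0) by (unfold s; lra).
  exists (exp (ln eps / s)). split; [apply exp_pos|]. intros n.
  assert (Hn := pos_INR n). set (x := INR n + 1). assert (Hx : 1 <= x) by (unfold x; lra).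
  assert (E : weight nu n = Rpower x s * x).
  { unfold weight. fold x. rewrite <- (Rpower_1 x) at 3 by lra. rewrite <- Rpower_plus.
    f_equal. unfold s. ring. }
  rewrite E. assert (HK := exp_pos (ln eps / s)).
  destruct (Rle_lt_dec x (exp (ln eps / s))) as [Hle|Hlt].
  - assert (Rpower x s <= 1).
    { rewrite <- (Rpower_O x) by lra. apply Rle_Rpower; lra. }
    nra.
  - assert (Rpower x s <= eps); [|nra].
    unfold Rpower. rewrite <- (exp_ln eps Heps) at 1. left. apply exp_increasing.
    apply ln_increasing in Hlt; [|exact HK]. rewrite ln_exp in Hlt.
    apply (Rmult_lt_gt_compat_neg_l s) in Hlt; [|exact Hs].
    replace (s * (ln eps / s)) with (ln eps) in Hlt by (field; lra). lra.
Qed.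

(** Splitting the weights as [eps (n + 1) + K] turns the squared norm into an
    arithmetico-geometric and a geometric sum of ratio [|v|^2]. *)
Lemma norm_le_kernel nu (j : nat) eps : nu < 1 / 2 -> 0 < eps ->
  exists K, 0 < K /\ forall v, Cmod v < 1 ->
    norm_le nu (kernel j v) (sqrt (eps / (1 - Cmod v ^ 2) ^ 2 + K / (1 - Cmod v ^ 2))).
Proof.
  intros Hnu Heps.
  destruct (weight_sublinear nu eps Hnu Heps) as [K [HK HW]].
  assert (Hj := pos_INR j).
  exists (eps * INR j + K). split; [nra|]. intros v Hv.
  exists (kernel_coef j v). split; [now apply power_series_kernel|]. intros N.
  assert (Hv2 := Cmod_sqr_lt_1 v Hv). set (r := Cmod v ^ 2) in *.
  assert (Hr2 : 0 < (1 - r) ^ 2) by (apply pow_lt; lra).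
  rewrite pow2_sqrt.
  2:{ apply Rplus_le_le_0_compat; apply Rlt_le, Rdiv_lt_0_compat; nra. }
  eapply Rle_trans; [apply shifted_energy_le; intros m; apply Rlt_le, weight_pos|].
  apply Rle_trans with (sum_n (fun n => eps * ((INR n + 1) * r ^ n) + (eps * INR j + K) * r ^ n) N).
  - apply sum_n_le. intros n. rewrite Cmod_pow, <- pow_mult, Nat.mul_comm, pow_mult. fold r.
    specialize (HW (j + n)%nat). rewrite plus_INR in HW.
    assert (Hrn : 0 <= r ^ n) by (apply pow_le; lra).
    apply (Rmult_le_compat_l _ _ _ Hrn) in HW. lra.
  - rewrite sum_n_Rplus, !sum_n_Rmult.
    apply Rplus_le_compat; apply Rmult_le_compat_l; try nra.
    + now apply arith_geom_sum_le.
    + now apply geom_sum_le.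
Qed.

(** Quantitative form of: the norm of the kernel is [o(1 / (1 - |v|^2))],
    uniformly in [v], as [|v|] tends to 1. *)
Lemma kernel_small nu (j : nat) (M eps : R) : nu < 1 / 2 -> 0 < M -> 0 < eps ->
  exists theta, 0 < theta /\ forall v c, Cmod v < 1 ->
    Cmod c <= M * (1 - Cmod v ^ 2) -> Cmod c < theta ->
    norm_le nu (fun z => c * kernel j v z)%C eps.
Proof.
  intros Hnu HM Heps.
  set (e := eps ^ 2 / (2 * M ^ 2)).
  assert (He : 0 < e) by (apply Rdiv_lt_0_compat; nra).
  destruct (norm_le_kernel nu j e Hnu He) as [K [HK HN]].
  exists (eps ^ 2 / (2 * (K * M))).
  assert (HKM : 0 < K * M) by nra.
  split; [apply Rdiv_lt_0_compat; nra|].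
  intros v c Hv Hc Hct. assert (Hv2 := Cmod_sqr_lt_1 v Hv).
  assert (Hc0 := Cmod_ge_0 c).
  eapply norm_le_mono; [| |exact (norm_le_scal _ _ _ c (HN v Hv))].
  { apply Rmult_le_pos; [exact Hc0|apply sqrt_pos]. }
  set (d := 1 - Cmod v ^ 2) in *. set (x := Cmod c) in *.
  assert (Hd : 0 < d) by (unfold d; lra).
  assert (Hq : 0 < e / d ^ 2 + K / d) by (apply Rplus_lt_0_compat; apply Rdiv_lt_0_compat; nra).
  rewrite <- (sqrt_pow2 x Hc0), <- sqrt_mult by nra.
  rewrite <- (sqrt_pow2 eps) by lra. apply sqrt_le_1_alt.
  (* The first term is small because [x / d <= M] and [e] was chosen small; the
     second has an extra factor [x < theta]. *)
  set (y := x / d).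
  assert (Hy : 0 <= y <= M).
  { assert (E : y * d = x) by (unfold y; field; lra).
    split; [apply Rmult_le_reg_r with d; lra|].
    apply Rmult_le_reg_r with d; lra. }
  replace (x ^ 2 * (e / d ^ 2 + K / d)) with (e * y ^ 2 + K * y * x) by (unfold y; field; lra).
  assert (H1 : e * y ^ 2 <= eps ^ 2 / 2).
  { replace (eps ^ 2 / 2) with (e * M ^ 2) by (unfold e; field; lra).
    apply Rmult_le_compat_l; [lra|]. apply pow_incr. exact Hy. }
  assert (H2 : K * y * x <= eps ^ 2 / 2).
  { apply Rle_trans with (K * M * (eps ^ 2 / (2 * (K * M)))); [|right; field; nra].
    apply Rmult_le_compat; try lra; [nra|]. apply Rmult_le_compat_l; lra. }
  lra.
Qed.

(** The composition of a kernel with [psi] is again a fraction with a single pole.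
    The conjugate of [v] is the preimage under [psi] of the conjugate of [w],
    whence the value of [1 - |v|^2]; [beta] is the derivative of the composition
    at 0. *)
Lemma kernel_transport (lam p w : C) (psi : disk -> disk) :
  mobius lam p psi -> Cmod w < 1 ->
  exists v beta, Cmod v < 1 /\
    (1 - Cmod v ^ 2) * Cmod (1 - w * p) ^ 2 = (1 - Cmod p ^ 2) * (1 - Cmod w ^ 2) /\
    Cmod beta * Cmod (1 - w * p) ^ 2 = Cmod w * (1 - Cmod p ^ 2) /\
    forall z, kernel 0 w (psi z) = (/ (1 - w * p) + beta * kernel 1 v z)%C.
Proof.
  intros [Hl [Hp H]] Hw.
  assert (Hd := one_minus_neq_0 (w * p) (Cmod_mult_lt_1 _ _ Hw Hp)).
  set (D := (1 - w * p)%C) in *.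
  assert (HD := proj1 (Cmod_gt_0 _) Hd).
  assert (Hw2 := Cmod_sqr_lt_1 w Hw). assert (Hp2 := Cmod_sqr_lt_1 p Hp).
  set (v := ((w - Cconj p) * lam / D)%C).
  set (beta := (lam * w * RtoC (1 - Cmod p ^ 2) / D ^ 2)%C).
  assert (Hv : (1 - Cmod v ^ 2) * Cmod D ^ 2 = (1 - Cmod p ^ 2) * (1 - Cmod w ^ 2)).
  { unfold v. rewrite Cmod_div, Cmod_mult, Hl by exact Hd.
    transitivity (Cmod D ^ 2 - Cmod (w - Cconj p) ^ 2); [field; lra|].
    unfold D. rewrite !Cmod_sqr. destruct w, p. simpl. ring. }
  assert (Hv1 : Cmod v < 1).
  { rewrite <- Cmod_1. apply Cmod_lt_sqr. rewrite Cmod_1.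
    assert (0 < Cmod D ^ 2) by now apply pow_lt. nra. }
  exists v, beta. split; [exact Hv1|split; [exact Hv|split]].
  - unfold beta. rewrite Cmod_div, Cmod_pow by now apply Cpow_nz.
    rewrite !Cmod_mult, Hl, Cmod_R, Rabs_pos_eq by lra. field. lra.
  - intros z. unfold kernel. specialize (H z).
    assert (Hz := mobius_denominator lam p (proj1_sig z) Hl Hp (proj2_sig z)).
    assert (Hvz := one_minus_neq_0 (v * proj1_sig z) (Cmod_mult_lt_1 _ _ Hv1 (proj2_sig z))).
    assert (Hwz := one_minus_neq_0 (w * proj1_sig (psi z))
      (Cmod_mult_lt_1 _ _ Hw (proj2_sig (psi z)))).
    set (x := proj1_sig z) in *. set (u := proj1_sig (psi z)) in *.
    set (den := (1 + Cconj p * lam * x)%C) in *.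
    (* The composition has its pole where [psi] takes the value [/ w]. *)
    assert (E : ((1 - w * u) * den = D * (1 - v * x))%C).
    { transitivity (den - w * (u * den))%C; [ring|]. rewrite H.
      unfold v, den, D. field. exact Hd. }
    assert (Eb : (beta = lam * w * (1 - p * Cconj p) / D ^ 2)%C).
    { unfold beta. rewrite RtoC_minus, <- Cmod2_conj. reflexivity. }
    transitivity (den / ((1 - w * u) * den))%C; [simpl; field; tauto|].
    rewrite E, Eb.
    assert (Hk : (D * (1 - v * x) <> 0)%C) by (rewrite <- E; now apply Cmult_neq_0).
    transitivity ((D * (1 - v * x) + lam * w * (1 - p * Cconj p) * x) / (D * (D * (1 - v * x))))%C.
    + transitivity (den * D / (D * (D * (1 - v * x))))%C; [field; tauto|].
      f_equal. unfold v, den, D. field. exact Hd.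
    + simpl. field. tauto.
Qed.

(** * Approximately killed functions *)

(** The estimate is uniform over all automorphisms sending the origin close to the
    circle, because it will be used for an iterate and for its inverse at once. *)
Definition approximately_killed (nu : R) (q : disk -> C) : Prop :=
  forall eps, 0 < eps -> exists eta, 0 < eta /\
    forall lam p psi, mobius lam p psi -> 1 - Cmod p ^ 2 < eta ->
      exists x, norm_le nu (fun z => x z - q z)%C eps /\ norm_le nu (fun z => x (psi z)) eps.

Lemma killed_ext nu q q' : (forall z, q z = q' z) ->
  approximately_killed nu q -> approximately_killed nu q'.
Proof. intros H. now rewrite (functional_extensionality q q' H). Qed.

(** The perturbation [x] found for an approximation of [q] serves for [q] too. *)
Lemma killed_limit nu q :
  (forall eps, 0 < eps -> exists q', approximately_killed nu q' /\
     norm_le nu (fun z => q' z - q z)%C eps) ->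
  approximately_killed nu q.
Proof.
  intros H eps Heps.
  destruct (H (eps / 2) ltac:(lra)) as [q' [Hq' Hd]].
  destruct (Hq' (eps / 2) ltac:(lra)) as [eta [Heta Hx]].
  exists eta. split; [exact Heta|]. intros lam p psi Hpsi Hp.
  destruct (Hx lam p psi Hpsi Hp) as [x [Hx1 Hx2]].
  exists x. split.
  - apply norm_le_ext with (fun z => (x z - q' z) + (q' z - q z))%C; [intros z; ring|].
    replace eps with (eps / 2 + eps / 2) by field. apply norm_le_plus; auto; lra.
  - apply norm_le_mono with (eps / 2); [lra|lra|exact Hx2].
Qed.

Lemma killed_plus nu q q' : approximately_killed nu q -> approximately_killed nu q' ->
  approximately_killed nu (fun z => q z + q' z)%C.
Proof.
  intros H H' eps Heps.
  destruct (H (eps / 2) ltac:(lra)) as [eta [Heta Hx]].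
  destruct (H' (eps / 2) ltac:(lra)) as [eta' [Heta' Hx']].
  exists (Rmin eta eta'). split; [now apply Rmin_pos|]. intros lam p psi Hpsi Hp.
  destruct (Hx lam p psi Hpsi) as [x [Hx1 Hx2]];
    [eapply Rlt_le_trans; [exact Hp|apply Rmin_l]|].
  destruct (Hx' lam p psi Hpsi) as [x' [Hx1' Hx2']];
    [eapply Rlt_le_trans; [exact Hp|apply Rmin_r]|].
  exists (fun z => x z + x' z)%C.
  replace eps with (eps / 2 + eps / 2) by field. split.
  - apply norm_le_ext with (fun z => (x z - q z) + (x' z - q' z))%C; [intros z; ring|].
    apply norm_le_plus; auto; lra.
  - apply norm_le_plus; auto; lra.
Qed.

Lemma killed_scal nu q (c : C) : approximately_killed nu q ->
  approximately_killed nu (fun z => c * q z)%C.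
Proof.
  intros H eps Heps. assert (Hc := Cmod_ge_0 c).
  set (e := eps / (Cmod c + 1)).
  assert (He : 0 < e) by (apply Rdiv_lt_0_compat; lra).
  assert (Hce : Cmod c * e <= eps).
  { replace eps with ((Cmod c + 1) * e) by (unfold e; field; lra).
    apply Rmult_le_compat_r; lra. }
  destruct (H e He) as [eta [Heta Hx]].
  exists eta. split; [exact Heta|]. intros lam p psi Hpsi Hp.
  destruct (Hx lam p psi Hpsi Hp) as [x [Hx1 Hx2]].
  exists (fun z => c * x z)%C.
  assert (Hce0 : 0 <= Cmod c * e) by nra.
  split; apply norm_le_mono with (Cmod c * e); auto.
  - apply norm_le_ext with (fun z => c * (x z - q z))%C; [intros z; ring|].
    now apply norm_le_scal.
  - now apply norm_le_scal.
Qed.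

(** The parameter [delta] controls how far the corrector is from 0, uniformly in
    [p]; once it is fixed, [1 - |p|^2] is taken small with respect to [delta],
    which makes what the corrector contributes after composition small. *)
Lemma killed_kernel nu (w : C) : nu < 1 / 2 -> Cmod w < 1 ->
  approximately_killed nu (kernel 0 w).
Proof.
  intros Hnu Hw eps Heps.
  assert (Hw2 := Cmod_sqr_lt_1 w Hw). assert (Hw0 := Cmod_ge_0 w).
  set (L := / (1 - Cmod w)). set (M := / (1 - Cmod w ^ 2)).
  assert (HL : L * (1 - Cmod w) = 1) by (unfold L; field; lra).
  assert (HM : M * (1 - Cmod w ^ 2) = 1) by (unfold M; field; lra).
  assert (HL0 : 0 < L) by (apply Rinv_0_lt_compat; lra).
  assert (HM0 : 0 < M) by (apply Rinv_0_lt_compat; lra).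
  destruct (kernel_small nu 0 L eps Hnu HL0 Heps) as [t0 [Ht0 Hsm0]].
  destruct (kernel_small nu 1 M (eps / 2) Hnu HM0 ltac:(lra)) as [t1 [Ht1 Hsm1]].
  destruct (kernel_small nu 1 L (eps / 2) Hnu HL0 ltac:(lra)) as [t2 [Ht2 Hsm2]].
  set (delta := Rmin (1 / 2) (t0 / (4 * L))).
  assert (Hdelta0 : 0 < delta) by (apply Rmin_pos; [lra|apply Rdiv_lt_0_compat; lra]).
  assert (Hdelta1 : delta <= 1 / 2) by apply Rmin_l.
  assert (Hdelta2 : L * delta <= t0 / 4).
  { replace (t0 / 4) with (L * (t0 / (4 * L))) by (field; lra).
    apply Rmult_le_compat_l; [lra|apply Rmin_r]. }
  set (eta := Rmin (t0 / (4 * L)) (Rmin (t1 / L ^ 2) (t2 * delta / L))).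
  assert (Heta0 : L * eta <= t0 / 4).
  { replace (t0 / 4) with (L * (t0 / (4 * L))) by (field; lra).
    apply Rmult_le_compat_l; [lra|apply Rmin_l]. }
  assert (Heta1 : L ^ 2 * eta <= t1).
  { replace t1 with (L ^ 2 * (t1 / L ^ 2)) by (field; lra).
    apply Rmult_le_compat_l; [nra|]. eapply Rle_trans; [apply Rmin_r|apply Rmin_l]. }
  assert (Heta2 : L * eta <= t2 * delta).
  { replace (t2 * delta) with (L * (t2 * delta / L)) by (field; lra).
    apply Rmult_le_compat_l; [lra|]. eapply Rle_trans; [apply Rmin_r|apply Rmin_r]. }
  assert (Heta : 0 < eta).
  { repeat apply Rmin_pos; apply Rdiv_lt_0_compat; nra. }
  exists eta. split; [exact Heta|]. intros lam p psi Hpsi Hpeta.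
  assert (Hp : Cmod p < 1) by apply Hpsi.
  assert (Hp2 := Cmod_sqr_lt_1 p Hp). assert (Hp0 := Cmod_ge_0 p).
  set (P := Cmod p ^ 2) in *.
  (* [s * kernel 0 W] takes the value 1 at [p], so that subtracting
     [/ D * s * kernel 0 W] removes the constant term [/ D] of the composition. *)
  set (W := (RtoC (1 - delta) * Cconj p)%C).
  set (s := 1 - (1 - delta) * P).
  assert (HWm : Cmod W = (1 - delta) * Cmod p).
  { unfold W. rewrite Cmod_mult, Cmod_R, Cmod_conj, Rabs_pos_eq; lra. }
  assert (HW : Cmod W < 1) by (rewrite HWm; nra).
  assert (HWP : Cmod W ^ 2 = (1 - delta) ^ 2 * P) by (rewrite HWm; unfold P; ring).
  assert (HWp : (1 - W * p = RtoC s)%C).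
  { unfold W. transitivity (1 - RtoC (1 - delta) * (p * Cconj p))%C; [ring|].
    now rewrite <- Cmod2_conj, <- RtoC_mult, <- RtoC_minus. }
  assert (Hs1 : delta <= s) by (unfold s; nra).
  assert (Hs2 : s <= delta + (1 - P)) by (unfold s; nra).
  assert (Hs3 : s <= 1 - Cmod W ^ 2) by (rewrite HWP; unfold s; nra).
  assert (HsC : Cmod (RtoC s) = s) by (rewrite Cmod_R, Rabs_pos_eq; lra).
  assert (Hs0 : RtoC s <> 0%C) by (apply Cmod_gt_0; lra).
  assert (Hd := one_minus_neq_0 (w * p) (Cmod_mult_lt_1 _ _ Hw Hp)).
  destruct (kernel_transport lam p w psi Hpsi Hw) as [v [beta [Hv [Hv2 [Hb Htr]]]]].
  destruct (kernel_transport lam p W psi Hpsi HW) as [V [Beta [HV [HV2 [HB HTr]]]]].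
  rewrite HWp, HsC in *. fold P in Hv2, Hb, HV2, HB.
  set (D := (1 - w * p)%C) in *.
  assert (HDm := proj1 (Cmod_gt_0 _) Hd).
  assert (HDL : 1 <= L * Cmod D).
  { rewrite <- HL. apply Rmult_le_compat_l; [lra|].
    assert (H := Cmod_triangle D (w * p)).
    replace (D + w * p)%C with (RtoC 1) in H by (unfold D; ring).
    rewrite Cmod_1, Cmod_mult in H. nra. }
  assert (HinvD : Cmod (/ D) <= L).
  { rewrite Cmod_inv by exact Hd. apply Rmult_le_reg_r with (Cmod D); [exact HDm|].
    rewrite Rinv_l by lra. exact HDL. }
  assert (HinvD0 := Cmod_ge_0 (/ D)). assert (Hb0 := Cmod_ge_0 beta).
  assert (HB0 := Cmod_ge_0 Beta).
  exists (fun z => kernel 0 w z - (/ D * RtoC s) * kernel 0 W z)%C. split.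
  - apply norm_le_ext with (fun z => (- (/ D * RtoC s)) * kernel 0 W z)%C; [intros z; ring|].
    assert (Hle : Cmod (- (/ D * RtoC s)) <= L * s).
    { rewrite Cmod_opp, Cmod_mult, HsC. apply Rmult_le_compat_r; lra. }
    apply Hsm0; [exact HW| |].
    + eapply Rle_trans; [exact Hle|]. apply Rmult_le_compat_l; lra.
    + eapply Rle_lt_trans; [exact Hle|].
      apply Rle_lt_trans with (L * delta + L * (1 - P)); [nra|].
      assert (L * (1 - P) <= L * eta) by (apply Rmult_le_compat_l; lra). lra.
  - apply norm_le_ext with (fun z => beta * kernel 1 v z - (/ D * RtoC s * Beta) * kernel 1 V z)%C.
    { intros z. rewrite Htr, HTr. field. tauto. }
    assert (HD2 : 0 < Cmod D ^ 2) by now apply pow_lt.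
    replace eps with (eps / 2 + eps / 2) by field.
    apply norm_le_minus; [lra|lra|apply Hsm1|apply Hsm2]; auto.
    + apply Rmult_le_reg_r with (Cmod D ^ 2); [exact HD2|].
      rewrite Rmult_assoc, Hv2, Hb.
      replace (M * ((1 - P) * (1 - Cmod w ^ 2))) with (M * (1 - Cmod w ^ 2) * (1 - P)) by ring.
      rewrite HM.
      nra.
    + apply Rle_lt_trans with (L ^ 2 * (1 - P)).
      * apply Rmult_le_reg_r with (Cmod D ^ 2); [exact HD2|]. rewrite Hb.
        replace (L ^ 2 * (1 - P) * Cmod D ^ 2) with ((L * Cmod D) ^ 2 * (1 - P)) by ring.
        assert (1 <= (L * Cmod D) ^ 2) by nra. nra.
      * apply Rlt_le_trans with (L ^ 2 * eta); [|exact Heta1].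
        apply Rmult_lt_compat_l; [nra|exact Hpeta].
    + rewrite !Cmod_mult, HsC, Rmult_assoc.
      apply Rmult_le_compat; [lra|nra|exact HinvD|].
      apply Rmult_le_reg_r with (s ^ 2); [nra|].
      rewrite HV2, Rmult_assoc, HB.
      replace (s * (Cmod W * (1 - P))) with ((1 - P) * (Cmod W * s)) by ring.
      apply Rmult_le_compat_l; [lra|].
      assert (Cmod W * s <= 1 * s) by (apply Rmult_le_compat_r; lra). lra.
    + rewrite !Cmod_mult, HsC, Rmult_assoc.
      assert (HsB : s * Cmod Beta <= (1 - P) / delta).
      { apply Rmult_le_reg_r with (s * delta); [apply Rmult_lt_0_compat; lra|].
        replace (s * Cmod Beta * (s * delta)) with (delta * (Cmod Beta * s ^ 2)) by ring.
        replace ((1 - P) / delta * (s * delta)) with (s * (1 - P)) by (field; lra).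
        rewrite HB. apply Rmult_le_compat; [lra| |exact Hs1|].
        - apply Rmult_le_pos; [apply Cmod_ge_0|lra].
        - rewrite <- (Rmult_1_l (1 - P)) at 2. apply Rmult_le_compat_r; lra. }
      apply Rle_lt_trans with (L * ((1 - P) / delta)).
      * apply Rmult_le_compat; try lra. nra.
      * apply Rmult_lt_reg_r with delta; [exact Hdelta0|].
        replace (L * ((1 - P) / delta) * delta) with (L * (1 - P)) by (field; lra).
        apply Rlt_le_trans with (L * eta); [|exact Heta2].
        apply Rmult_lt_compat_l; lra.
Qed.

Lemma kernel_step (n : nat) (t : C) (z : disk) : Cmod t < 1 ->
  (kernel n t z - proj1_sig z ^ n = t * kernel (S n) t z)%C.
Proof.
  intros Ht. unfold kernel. simpl.
  assert (H := one_minus_neq_0 (t * proj1_sig z) (Cmod_mult_lt_1 _ _ Ht (proj2_sig z))).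
  field. exact H.
Qed.

(** By induction along [kernel_step]: [z^n] is the limit of [kernel n t] as [t]
    tends to 0, and [kernel (n + 1) t] is a multiple of
    [kernel n t - z^n]. *)
Lemma killed_monomial nu (n : nat) : nu < 1 / 2 ->
  approximately_killed nu (fun z => (proj1_sig z ^ n)%C).
Proof.
  intros Hnu.
  assert (Hmono : forall n,
    (forall t, 0 < t < 1 -> approximately_killed nu (kernel n (RtoC t))) ->
    approximately_killed nu (fun z => (proj1_sig z ^ n)%C)).
  { intros m Hg. apply killed_limit. intros eps Heps.
    destruct (kernel_small nu (S m) 1 eps Hnu Rlt_0_1 Heps) as [theta [Ht Hsm]].
    set (t := Rmin (1 / 2) (theta / 2)).
    assert (Ht0 : 0 < t) by (apply Rmin_pos; lra).
    assert (Ht1 : t <= 1 / 2) by apply Rmin_l.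
    assert (Ht2 : t <= theta / 2) by apply Rmin_r.
    assert (HtC : Cmod (RtoC t) = t) by (rewrite Cmod_R, Rabs_pos_eq; lra).
    exists (kernel m (RtoC t)). split; [apply Hg; lra|].
    apply norm_le_ext with (fun z => RtoC t * kernel (S m) (RtoC t) z)%C.
    { intros z. symmetry. apply kernel_step. lra. }
    apply Hsm; rewrite HtC; nra. }
  apply Hmono. induction n as [|n IH]; intros t Ht.
  - apply killed_kernel; [exact Hnu|]. rewrite Cmod_R, Rabs_pos_eq; lra.
  - assert (HtC : Cmod (RtoC t) = t) by (rewrite Cmod_R, Rabs_pos_eq; lra).
    apply killed_ext with
      (fun z => / RtoC t * (kernel n (RtoC t) z + (- (1)) * (proj1_sig z ^ n)))%C.
    { intros z. replace (kernel n (RtoC t) z + - (1) * proj1_sig z ^ n)%C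
        with (kernel n (RtoC t) z - proj1_sig z ^ n)%C by ring.
      rewrite kernel_step by lra. field. apply Cmod_gt_0. lra. }
    apply killed_scal, killed_plus; [now apply IH|].
    apply killed_scal, Hmono, IH.
Qed.

Fixpoint taylor_polynomial (a : nat -> C) (N : nat) (z : disk) : C :=
  match N with
  | 0%nat => 0%C
  | S N => (taylor_polynomial a N z + a N * proj1_sig z ^ N)%C
  end.

Definition tail_coef (a : nat -> C) (N n : nat) : C := if (n <? N)%nat then 0%C else a n.

Lemma power_series_tail (a : nat -> C) (f : disk -> C) (N : nat) :
  power_series_on_disk a f ->
  power_series_on_disk (tail_coef a N) (fun z => f z - taylor_polynomial a N z)%C.
Proof.
  intros Ha. induction N as [|N IH]; intros z.
  - simpl. replace (f z - 0)%C with (f z) by ring. apply Ha.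
  - assert (H0 : power_series_on_disk (kernel_coef N 0) (kernel N 0))
      by (apply power_series_kernel; rewrite Cmod_0; lra).
    assert (H := is_pseries_plus _ _ _ _ _ (IH z)
      (is_pseries_scal (K := C_AbsRing) (V := C_NormedModule) (- a N)%C _ _ _
        (Cmult_comm _ _) (H0 z))).
    rewrite kernel_monomial in H. simpl.
    replace (f z - (taylor_polynomial a N z + a N * proj1_sig z ^ N))%C
      with (f z - taylor_polynomial a N z + - a N * proj1_sig z ^ N)%C by ring.
    revert H. apply is_pseries_ext. intros n.
    unfold PS_plus, PS_scal. change plus with Cplus. change scal with Cmult.
    rewrite kernel_coef_0. unfold tail_coef.
    match goal with |- ?x = ?y => change (@eq C x y) end.
    destruct (Nat.ltb_spec n N), (Nat.ltb_spec n (S N)), (Nat.eq_dec n N) as [E|E];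
      try lia; try rewrite E; ring.
Qed.

Lemma killed_polynomial nu a N : nu < 1 / 2 ->
  approximately_killed nu (taylor_polynomial a N).
Proof.
  intros Hnu. induction N as [|N IH].
  - apply killed_ext with (fun z => 0 * proj1_sig z ^ 0)%C; [intros z; simpl; ring|].
    now apply killed_scal, killed_monomial.
  - apply (killed_plus nu _ _ IH). now apply killed_scal, killed_monomial.
Qed.

Lemma tail_energy nu (a : nat -> C) N i :
  energy nu (tail_coef a (S N)) (N + i) = energy nu a (N + i) - energy nu a N.
Proof.
  assert (H0 : forall m, (m <= N)%nat -> energy nu (tail_coef a (S N)) m = 0).
  { intros m. unfold energy, tail_coef.
    induction m as [|m IH]; intros Hm; [rewrite sum_O|rewrite sum_Sn, IH by lia];
      match goal with |- context [(?x <? ?y)%nat] => destruct (Nat.ltb_spec x y) end; try lia;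
      rewrite Cmod_0; unfold plus; simpl; ring. }
  induction i as [|i IH].
  - rewrite Nat.add_0_r, H0 by lia. ring.
  - rewrite Nat.add_succ_r. unfold energy in *. rewrite !sum_Sn, IH.
    unfold tail_coef. destruct (Nat.ltb_spec (S (N + i)) (S N)); [lia|].
    unfold plus; simpl. ring.
Qed.

Lemma killed_space nu f : nu < 1 / 2 -> dirichlet_space nu f -> approximately_killed nu f.
Proof.
  intros Hnu [Ha [l Hl]]. set (a := taylor f) in *.
  apply killed_limit. intros eps Heps.
  change (is_lim_seq (energy nu a) l) in Hl.
  assert (Hinc : forall n, energy nu a n <= energy nu a (S n))
    by (intros n; apply sum_n_incr, energy_term_ge_0).
  assert (Hle := is_lim_seq_incr_compare _ _ Hl Hinc).
  assert (He : 0 < eps ^ 2) by nra.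
  destruct (proj2 (is_lim_seq_spec _ _) Hl (mkposreal _ He)) as [N HN].
  specialize (HN N (Nat.le_refl N)). simpl in HN.
  apply Rabs_def2 in HN.
  exists (taylor_polynomial a (S N)). split; [now apply killed_polynomial|].
  apply norm_le_ext with (fun z => (- (1)) * (f z - taylor_polynomial a (S N) z))%C;
    [intros z; ring|].
  replace eps with (Cmod (- (1)) * eps) by (rewrite Cmod_m1; ring).
  apply norm_le_scal. exists (tail_coef a (S N)).
  split; [now apply power_series_tail|]. intros m.
  apply Rle_trans with (energy nu (tail_coef a (S N)) (N + m)).
  - apply sum_n_mono, energy_term_ge_0.
  - rewrite tail_energy. specialize (Hle (N + m)%nat). simpl in *. lra.
Qed.

Lemma recurrent_of_escape nu (psi : disk -> disk) : nu < 1 / 2 ->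
  (forall eta, 0 < eta -> exists k lam q, (0 < k)%nat /\
     mobius lam q (Nat.iter k psi) /\ 1 - Cmod q ^ 2 < eta) ->
  recurrent (dirichlet_space nu) (dirichlet_norm nu) (composition_operator psi).
Proof.
  intros Hnu Hesc U [HU Hopen] [f Hf].
  assert (HXf := HU f Hf).
  destruct (Hopen f Hf) as [eps [Heps Hball]].
  destruct (killed_space nu f Hnu HXf (eps / 4) ltac:(lra)) as [eta [Heta Hkill]].
  destruct (Hesc eta Heta) as [k [lam [q [Hk [Hmob Hq]]]]].
  exists k. split; [exact Hk|].
  set (chi := Nat.iter k psi) in *.
  destruct (mobius_inverse lam q chi Hmob) as [chi' [lam' [q' [Hmob' [Hq' Hinv]]]]].
  destruct (Hkill lam q chi Hmob Hq) as [x [Hx1 Hx2]].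
  destruct (Hkill lam' q' chi' Hmob' ltac:(rewrite Hq'; exact Hq)) as [y [Hy1 Hy2]].
  assert (Hin : forall g, norm_le nu (fun z => g z - f z)%C (eps / 2) -> U g).
  { intros g Hg. apply Hball.
    - apply (space_of_difference nu f g (eps / 2)); [exact HXf|lra|exact Hg].
    - apply norm_le_space in Hg; [|lra]. lra. }
  assert (Hhalf : eps / 4 + eps / 4 = eps / 2) by field.
  exists (fun z => x z + y (chi' z))%C. split; apply Hin; rewrite <- Hhalf.
  - apply norm_le_ext with (fun z => (x z - f z) + y (chi' z))%C; [intros z; ring|].
    apply norm_le_plus; auto; lra.
  - apply norm_le_ext with (fun z => x (chi z) + (y z - f z))%C.
    { intros z. rewrite iter_composition_operator. fold chi. rewrite Hinv. ring. }
    apply norm_le_plus; auto; lra.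
Qed.

Theorem theorem5p12 (nu : R) (phi : lft) (Hphi : disk_automorphism phi)
    (Htype : parabolic phi \/ hyperbolic phi) :
  recurrent (dirichlet_space nu) (dirichlet_norm nu)
    (composition_operator (disk_map phi Hphi))
  <-> nu < 1 / 2.
Proof.
  destruct (disk_automorphism_normal_form phi Hphi) as [lam [p [Hl [Hp [Hd [Ha [Hb Hc]]]]]]].
  assert (Hmob := mobius_disk_map phi Hphi lam p Hl Hp Hd Ha Hb Hc).
  destruct (non_elliptic phi lam p Htype Hl Hp Hd Ha Hb Hc) as [Hp0 Hell].
  set (psi := disk_map phi Hphi) in *.
  assert (Hp2 := Cmod_sqr_lt_1 p Hp).
  assert (HP : 0 < Cmod p ^ 2) by (apply pow_lt; now apply Cmod_gt_0).
  assert (Horb : forall k, exists mu q, mobius mu q (Nat.iter k psi) /\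
    INR k ^ 2 * Cmod p ^ 2 * (1 - Cmod q ^ 2) <= Cmod q ^ 2 * (1 - Cmod p ^ 2)).
  { intros k. destruct (mobius_iter lam p psi k Hmob) as [mu [q Hq]].
    exists mu, q. split; [exact Hq|].
    rewrite <- (mobius_origin _ _ _ Hq). now apply (orbit_escape lam). }
  split.
  - intros Hrec. destruct (Rlt_le_dec nu (1 / 2)) as [|Hnu]; [assumption|exfalso].
    apply (not_recurrent nu psi (Cmod p ^ 2)); [exact Hnu|lra| |exact Hrec].
    intros k Hk. destruct (Horb k) as [mu [q [Hq Hesc]]]. exists mu, q. split; [exact Hq|].
    assert (Hq2 := Cmod_sqr_lt_1 q (proj1 (proj2 Hq))).
    assert (Hk1 : 1 <= INR k) by (apply (le_INR 1); lia).
    assert (Hk2 : 1 <= INR k ^ 2) by nra.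
    rewrite Rmult_assoc in Hesc.
    assert (Hle : 1 * (Cmod p ^ 2 * (1 - Cmod q ^ 2))
                  <= INR k ^ 2 * (Cmod p ^ 2 * (1 - Cmod q ^ 2))).
    { apply Rmult_le_compat_r; [|exact Hk2]. apply Rmult_le_pos; lra. }
    lra.
  - intros Hnu. apply recurrent_of_escape; [exact Hnu|]. intros eta Heta.
    destruct (INR_unbounded (/ (Cmod p ^ 2 * eta) + 1)) as [k Hk].
    assert (Hpe : 0 < Cmod p ^ 2 * eta) by nra.
    assert (Hinv : 0 < / (Cmod p ^ 2 * eta)) by now apply Rinv_0_lt_compat.
    destruct (Horb k) as [mu [q [Hq Hesc]]]. exists k, mu, q.
    split; [|split; [exact Hq|]].
    { destruct k; [change (INR 0) with 0 in Hk; lra|lia]. }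
    assert (Hq2 := Cmod_sqr_lt_1 q (proj1 (proj2 Hq))).
    apply Rnot_le_lt. intros Hle.
    assert (H1 : 1 < INR k * (Cmod p ^ 2 * eta)).
    { rewrite <- (Rinv_l (Cmod p ^ 2 * eta)) by lra. apply Rmult_lt_compat_r; lra. }
    assert (H2 : INR k * (Cmod p ^ 2 * eta) <= INR k ^ 2 * (Cmod p ^ 2 * eta)).
    { apply Rmult_le_compat_r; nra. }
    assert (H3 : INR k ^ 2 * (Cmod p ^ 2 * eta) <= INR k ^ 2 * (Cmod p ^ 2 * (1 - Cmod q ^ 2))).
    { apply Rmult_le_compat_l; [apply pow2_ge_0|]. apply Rmult_le_compat_l; lra. }
    nra.
Qed.
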